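(* Let $(\Omega,\mathcal F,\mu)$ be a probability space and $1<p<\infty$. Then $$K_p:=\sup_{N\in\mathbb N}\big\|P_1:L^p(\Omega^N)\to L^p(\Omega^N)\big\|<\infty,$$ and for every $m\ge 1$, $$\sup_{N\in\mathbb N}\big\|P_m:L^p(\Omega^N)\to L^p(\Omega^N)\big\|\le \frac1{e}\,\big(e\,K_p\big)^m .$$
   Context: For $N\in\mathbb N$, $\Omega^N$ carries the product probability measure $\mu^{\otimes N}$, and $[1,N]=\{1,\dots,N\}$. For $A\subseteq[1,N]$, $\mathbb E_A$ is the conditional expectation onto the $\sigma$-algebra generated by the coordinates in $A$, i.e. $\mathbb E_Af(x)=\int f(x_A,y_{[1,N]\setminus A})\,d\mu^{\otimes([1,N]\setminus A)}(y)$; in particular $\mathbb E_\emptyset f=\mathbb E f$ is the mean. The Hoeffding projections are $P_A=\sum_{B\subseteq A}(-1)^{|A\setminus B|}\mathbb E_B$ (equivalently $P_A=(\mathrm{id}-\mathbb E)^{\otimes A}\otimes\mathbb E^{\otimes([1,N]\setminus A)}$), and $P_m=\sum_{A\subseteq[1,N],\,|A|=m}P_A$. These are mutually orthogonal orthogonal projections on $L^2(\Omega^N)$, and $P_m$ is the orthogonal projection onto the closed span of functions depending on at most $m$ coordinates intersected with the orthogonal complement of those depending on at most $m-1$ coordinates. *)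

(* Defs.v *)
From HB Require Import structures.
From mathcomp Require Import all_boot all_order all_algebra.
From mathcomp Require Import all_classical all_reals all_analysis.
Set Implicit Arguments. Unset Strict Implicit. Unset Printing Implicit Defensive.
Import Order.TTheory GRing.Theory Num.Theory.
Local Open Scope classical_set_scope.
Local Open Scope ring_scope.

Section Hoeffding.
Context d (T : measurableType d) (R : realType).

Definition mixt N (A : {set 'I_N}) (x y : N.-tuple T) : N.-tuple T :=
  [tuple (if i \in A then tnth x i else tnth y i) | i < N].

(* product measures: muN N is mu^{\otimes N} on Omega^N = N.-tuple T,
   characterised on measurable rectangles (which determines it uniquely) *)
Definition is_product_measure_family (mu : {measure set T -> \bar R})
    (muN : forall N : nat, {measure set (N.-tuple T) -> \bar R}) : Prop :=
  forall (N : nat) (B : 'I_N -> set T), (forall i, measurable (B i)) ->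
    muN N [set x | forall i, B i (tnth x i)] = (\prod_(i < N) mu (B i))%E.

Variable muN : forall N : nat, {measure set (N.-tuple T) -> \bar R}.

Definition condE N (A : {set 'I_N}) (f : N.-tuple T -> R) : N.-tuple T -> R :=
  fun x => Rintegral (muN N) setT (fun y => f (mixt A x y)).

Definition hoeffP N (A : {set 'I_N}) (f : N.-tuple T -> R) : N.-tuple T -> R :=
  fun x => \sum_(B : {set 'I_N} | B \subset A) (-1) ^+ #|A :\: B| * condE B f x.

Definition hoeffPm N (m : nat) (f : N.-tuple T -> R) : N.-tuple T -> R :=
  fun x => \sum_(A : {set 'I_N} | #|A| == m) hoeffP A f x.

Definition LpN N (p : R) (f : N.-tuple T -> R) : \bar R :=
  Lnorm (muN N) p%:E (EFin \o f).

Definition opnormLp N (p : R)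
    (Op : (N.-tuple T -> R) -> (N.-tuple T -> R)) : \bar R :=
  ereal_sup [set LpN p (Op f) | f in
     [set f : N.-tuple T -> R | measurable_fun setT f /\ (LpN p f <= 1)%E]].

End Hoeffding.

(* Main.v *)
Require Import Defs.
From HB Require Import structures.
From mathcomp Require Import all_boot all_order all_algebra.
From mathcomp Require Import all_classical all_reals all_analysis.
From mathcomp Require Import measurable_realfun.
From mathcomp Require Import ring lra.
Set Implicit Arguments. Unset Strict Implicit. Unset Printing Implicit Defensive.
Import Order.TTheory GRing.Theory Num.Theory.
Import numFieldNormedType.Exports.
Local Open Scope classical_set_scope.
Local Open Scope ring_scope.

(**
Boundedness of [P_1]. Let [2 <= p], [d_i = E_{i} f - E f] and [X = P_1 f], the
sum of the [d_i]. Clarkson's inequality along the martingale [E_{1..n} f] gives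
[sum_i E|d_i|^r <= 2^(r-1) E|f|^r] for every [r >= 2]. With [X_i = X - d_i] and
[h(x) = sign(x) |x|^(p-1)], independence yields
[E|X|^p = sum_i E d_i (h(X) - h(X_i))
  <= C sum_i (E d_i^2 E|X_i|^(p-2) + E|d_i|^p)], and [E|X_i|^p <= E|X|^p]
because [X_i] is a conditional expectation of [X]; the term [E|X_i|^(p-2)] is
then absorbed in the left-hand side. As [P_1] is self-adjoint, the case [p < 2]
follows by duality.

Higher orders. For a colouring [c] of the coordinates by [m] colours, the
composition of the operators [P_1] acting on the colour classes has norm at most
[K^m] by Fubini, and it selects the [P_A] such that [A] meets every colour class
exactly once. A set [A] of size [m] is selected by a fraction [m! / m^m] of all
colourings, so [P_m] is [m^m / m!] times the average over [c] of these
compositions, and [m^m / m! <= e^(m-1)].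

These identities hold pointwise for bounded measurable functions; truncation,
dominated convergence and Fatou's lemma extend the bounds to [L^p].
*)

(** * Inequalities for powers *)

Section real_inequalities.
Context {R : realType}.
Implicit Types (p q r s t x y u v : R).

(* [sign(x) |x|^(p-1)]; for [p < 2] the factor [x] hides the value [0 `^ (p - 2)]. *)
Definition sgpow p x : R := x * `|x| `^ (p - 2).

Lemma mulr_sgpow p x : p != 0 -> x * sgpow p x = `|x| `^ p.
Proof.
move=> p0; have [->|x0] := eqVneq x 0.
  by rewrite mul0r normr0 powR0.
rewrite /sgpow mulrA -expr2 -real_normK ?num_real// -powR_mulrn// -powRD.
  by congr (_ `^ _); lra.
by apply/implyP => _; rewrite normr_eq0.
Qed.

Lemma norm_sgpow p x : p != 1 -> `|sgpow p x| = `|x| `^ (p - 1).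
Proof.
move=> p1; have [->|x0] := eqVneq x 0.
  by rewrite /sgpow mul0r normr0 powR0// subr_eq0.
rewrite /sgpow normrM (ger0_norm (powR_ge0 _ _)).
rewrite -{1}[`|x|]powRr1// -powRD; last by apply/implyP => _; rewrite normr_eq0.
by congr (_ `^ _); lra.
Qed.

(** Convexity of |t|^p, with supporting line of slope p [sgpow p s] at [s]. For p > 1 it is Young's
    inequality applied to |s|^(p-1) and |t|; for p = 1, [sgpow] is the sign function. The Jensen
    inequalities below all come from it. *)
Lemma powR_tangent p s t : 1 <= p ->
  `|s| `^ p + p * (sgpow p s * (t - s)) <= `|t| `^ p.
Proof.
move=> p1; have p0 : 0 < p by lra.
rewrite mulrBr -[X in _ - X]mulrC mulr_sgpow ?gt_eqF//.
move: p1; rewrite le_eqVlt => /predU1P[<-|p1].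
  rewrite mul1r !powRr1// /sgpow.
  rewrite [X in X <= _](_ : _ = s * `|s| `^ (1 - 2) * t); last by ring.
  apply: le_trans (ler_norm _) _; rewrite !normrM (ger0_norm (powR_ge0 _ _)).
  have -> : (1 - 2 : R) = -1 by lra.
  rewrite powR_inv1//; have [->|s0] := eqVneq s 0; first by rewrite normr0 !mul0r.
  by rewrite divff ?mul1r// normr_eq0.
have Y : `|s| `^ (p - 1) * `|t| <= `|s| `^ p * ((p - 1) / p) + `|t| `^ p / p.
  have := @conjugate_powR _ (`|s| `^ (p - 1)) `|t| (p / (p - 1)) p (powR_ge0 _ _) (normr_ge0 _).
  rewrite -powRrM (_ : (p - 1) * (p / (p - 1)) = p); last by field; lra.
  rewrite invf_div; apply; last by field; lra.
    by apply: divr_gt0; lra.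
  by [].
have Z : sgpow p s * t <= `|s| `^ (p - 1) * `|t|.
  by rewrite -norm_sgpow ?gt_eqF// -normrM ler_norm.
have {Y}Z := le_trans Z Y.
have : p * (sgpow p s * t) <= `|s| `^ p * (p - 1) + `|t| `^ p.
  rewrite [X in _ <= X](_ : _ = p * (`|s| `^ p * ((p - 1) / p) + `|t| `^ p / p)); last by field; lra.
  by rewrite ler_pM2l.
by lra.
Qed.

(** With a = p - 2 and |y| <= |x|, the difference is (x - y)|x|^a + y(|x|^a - |y|^a), and the second
    term is controlled by the tangent inequality for the exponent a + 1. *)
Lemma sgpow_lipschitz p x y : 2 <= p ->
  `|sgpow p x - sgpow p y| <=
  (p - 1) * `|x - y| * (`|x| `^ (p - 2) + `|y| `^ (p - 2)).
Proof.
move=> p2; wlog yx : x y / `|y| <= `|x|.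
  move=> H; have [/H//|/ltW/H] := leP `|y| `|x|.
  by rewrite (distrC (sgpow p y)) (distrC y) [`|y| `^ _ + _]addrC.
set a := p - 2; have a0 : 0 <= a by rewrite /a; lra.
have -> : sgpow p x - sgpow p y =
    (x - y) * `|x| `^ a + y * (`|x| `^ a - `|y| `^ a) by rewrite /sgpow -/a; ring.
apply: le_trans (ler_normD _ _) _; rewrite !normrM (ger0_norm (powR_ge0 _ _)).
have le_a : `|y| `^ a <= `|x| `^ a by apply: ge0_ler_powR; rewrite ?nnegrE.
rewrite (ger0_norm (_ : 0 <= `|x| `^ a - _)) ?subr_ge0//.
have H : `|y| * (`|x| `^ a - `|y| `^ a) <= a * (`|x| - `|y|) * `|x| `^ a.
  have := @powR_tangent (a + 1) `|x| `|y| ltac:(lra).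
  rewrite !normr_id /sgpow !normr_id (_ : a + 1 - 2 = (a - 1)); last by ring.
  (* At z = 0 the identity fails for a = 0, because z^a is then 1; hence p = 2 is a separate
     case. *)
  have E z : 0 <= z -> z * z `^ (a - 1) = z `^ a \/ (a = 0).
    by move=> z0; have [->|an] := eqVneq a 0; [right|left; apply: mulr_powRB1 => //; lra].
  have P z : 0 <= z -> z `^ (a + 1) = z * z `^ a.
    move=> z0; rewrite -mulr_powRB1 //; last lra.
    by rewrite addrK.
  rewrite !P//; case: (E `|x|) => // [->|->]; first by lra.
  by rewrite !powRr0; lra.
have D : `|x| - `|y| <= `|x - y| by exact: lerB_dist.
have X0 : 0 <= `|x| `^ a by exact: powR_ge0.
have Y0 : 0 <= `|y| `^ a by exact: powR_ge0.
have H2 : a * (`|x| - `|y|) * `|x| `^ a <= a * `|x - y| * `|x| `^ a.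
  by rewrite ler_wpM2r// ler_wpM2l.
have N0 := normr_ge0 (x - y).
have H3 : 0 <= (p - 1) * `|x - y| * `|y| `^ a.
  by rewrite !mulr_ge0//; rewrite /a in a0; lra.
have -> : p - 1 = a + 1 by rewrite /a; ring.
have := mulr_ge0 N0 Y0; have := mulr_ge0 (mulr_ge0 a0 N0) Y0.
by lra.
Qed.

Lemma powRD_le r s t : 0 <= r -> 0 <= s -> 0 <= t ->
  (s + t) `^ r <= 2 `^ r * (s `^ r + t `^ r).
Proof.
move=> r0 s0 t0; wlog st : s t s0 t0 / s <= t.
  move=> H; have [/H|/ltW/H] := leP s t; first exact.
  by rewrite addrC [_ + t `^ r]addrC; apply.
apply: (@le_trans _ _ ((2 * t) `^ r)).
  by apply: ge0_ler_powR; rewrite ?nnegrE//; lra.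
by rewrite powRM// ler_wpM2l ?powR_ge0// lerDr powR_ge0.
Qed.

(** The bound separates [u] from [v], so that independence can factor its mean. It follows from the
    Lipschitz estimate once |u + v|^(p-2) is split. *)
Lemma sgpow_increment p : 2 <= p -> exists2 C, 0 <= C &
  forall u v, v * (sgpow p (u + v) - sgpow p u) <=
    C * (v ^+ 2 * `|u| `^ (p - 2) + `|v| `^ p).
Proof.
move=> p2; have T0 := powR_ge0 (2:R) (p - 2).
exists ((p - 1) * (1 + 2 `^ (p - 2))).
  by rewrite mulr_ge0//; lra.
move=> u v; apply: le_trans (ler_norm _) _; rewrite normrM.
apply: (@le_trans _ _ (`|v| * ((p - 1) * `|v| * (`|u + v| `^ (p - 2) + `|u| `^ (p - 2))))).
  rewrite ler_wpM2l//.
  by have := @sgpow_lipschitz p (u + v) u p2; rewrite [u + v - u]addrAC subrr add0r.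
have -> : `|v| `^ p = v ^+ 2 * `|v| `^ (p - 2).
  by rewrite -(@mulr_sgpow p v) ?gt_eqF//; [rewrite /sgpow; ring|lra].
rewrite -[v ^+ 2]real_normK ?num_real//.
have H : `|u + v| `^ (p - 2) <= 2 `^ (p - 2) * (`|u| `^ (p - 2) + `|v| `^ (p - 2)).
  apply: le_trans (@powRD_le (p - 2) `|u| `|v| _ _ _) => //; last lra.
  apply: ge0_ler_powR; rewrite ?nnegrE//; first lra.
  exact: ler_normD.
rewrite [X in X <= _](_ : _ = (p - 1) * `|v| ^+ 2 * (`|u + v| `^ (p - 2) + `|u| `^ (p - 2))); last by ring.
rewrite [X in _ <= X](_ : _ = (p - 1) * `|v| ^+ 2 * ((1 + 2 `^ (p - 2)) * (`|u| `^ (p - 2) + `|v| `^ (p - 2)))); last by ring.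
rewrite ler_wpM2l//; first by rewrite mulr_ge0 ?sqr_ge0//; lra.
have := powR_ge0 `|v| (p - 2); lra.
Qed.

(** Put r = p/2. Superadditivity of t^r and the parallelogram law bound the left side by m^r with m
    = (x^2 + y^2)/2; convexity of t^r at the midpoint [m] of x^2 and y^2 concludes. *)
Lemma clarkson p x y : 2 <= p ->
  `|(x + y) / 2| `^ p + `|(x - y) / 2| `^ p <= (`|x| `^ p + `|y| `^ p) / 2.
Proof.
move=> p2; set r := p / 2; have r1 : 1 <= r by rewrite /r; lra.
have E z : `|z| `^ p = (z ^+ 2) `^ r.
  rewrite -real_normK ?num_real// -powR_mulrn// -powRrM.
  by congr (_ `^ _); rewrite /r; lra.
rewrite !E.
have super a b : 0 <= a -> 0 <= b -> a `^ r + b `^ r <= (a + b) `^ r.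
  move=> a0 b0; have r0 : 0 < r by lra.
  rewrite -!(@mulr_powRB1 _ _ r) ?addr_ge0// mulrDl lerD// ler_wpM2l//.
    by apply: ge0_ler_powR; rewrite ?nnegrE//; lra.
  by apply: ge0_ler_powR; rewrite ?nnegrE//; lra.
apply: le_trans (super _ _ (sqr_ge0 _) (sqr_ge0 _)) _.
rewrite (_ : _ + _ = (x ^+ 2 + y ^+ 2) / 2); last by field.
set m := _ / 2; have m0 : 0 <= m by rewrite divr_ge0// addr_ge0// sqr_ge0.
have := @powR_tangent r m (x ^+ 2) r1; have := @powR_tangent r m (y ^+ 2) r1.
rewrite (ger0_norm m0) !ger0_norm ?sqr_ge0//.
have -> : x ^+ 2 - m = - (y ^+ 2 - m) by rewrite /m; field.
lra.
Qed.

(** Beyond the threshold b = e^(-1/2) the factor e t^2 is at least 1; below it the power is at most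
    b^(p-2). A small [e] later lets the p-th moment be absorbed. *)
Lemma powR_interpolate p e : 2 <= p -> 0 < e -> exists2 C, 0 <= C &
  forall t, 0 <= t -> t `^ (p - 2) <= e * t `^ p + C.
Proof.
move=> p2 e0; pose b := (Num.sqrt e)^-1.
have s0 : 0 < Num.sqrt e by rewrite sqrtr_gt0.
exists (b `^ (p - 2)); first exact: powR_ge0.
move=> t t0; have [tb|bt] := leP t b.
  apply: (@le_trans _ _ (b `^ (p - 2))); first apply: ge0_ler_powR; rewrite ?nnegrE//.
  - lra.
  - by rewrite invr_ge0 ltW.
  - by rewrite lerDr mulr_ge0 ?powR_ge0// ltW.
have -> : t `^ p = t ^+ 2 * t `^ (p - 2).
  by rewrite -{1}(ger0_norm t0) -(@mulr_sgpow p t) ?gt_eqF//; [rewrite /sgpow ger0_norm//; ring|lra].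
rewrite mulrA; apply: le_trans (_ : e * t ^+ 2 * t `^ (p - 2) <= _); last first.
  by rewrite lerDl powR_ge0.
rewrite ler_peMl ?powR_ge0//.
have -> : e * t ^+ 2 = (Num.sqrt e * t) ^+ 2 by rewrite exprMn sqr_sqrtr// ltW.
rewrite -(expr1n _ 2) ler_pXn2r ?nnegrE ?mulr_ge0 ?(ltW s0)//.
by move: bt; rewrite /b => /ltW; rewrite -(ler_pM2l s0) divff ?gt_eqF.
Qed.

Lemma young_eps p q e : 0 < p -> 0 < q -> p^-1 + q^-1 = 1 -> 0 < e ->
  exists2 C, 0 <= C & forall u v, `|u * v| <= C * `|u| `^ q + e * `|v| `^ p.
Proof.
(* Rescaling by [c], where c^p = e p, before Young's inequality turns the coefficient of |v|^p into
   [e]. *)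
move=> p0 q0 pq e0; pose c := (e * p) `^ p^-1.
have c0 : 0 < c by rewrite powR_gt0// mulr_gt0.
exists (c^-1 `^ q / q); first by rewrite divr_ge0 ?powR_ge0// ltW.
move=> u v; have := @conjugate_powR _ (c * `|v|) (c^-1 * `|u|) p q.
have ci : 0 <= c^-1 by rewrite invr_ge0 ltW.
have cp : c `^ p = e * p.
  by rewrite /c -powRrM mulVf ?gt_eqF// powRr1// mulr_ge0// ltW.
rewrite !powRM ?(ltW c0)// cp => H.
have {H} := H (mulr_ge0 (ltW c0) (normr_ge0 _)) (mulr_ge0 ci (normr_ge0 _)) p0 q0 pq.
rewrite normrM (_ : c * _ * _ = `|u| * `|v|); last by field; rewrite gt_eqF.
have -> : e * p * `|v| `^ p / p = e * `|v| `^ p by field; rewrite gt_eqF.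
lra.
Qed.

Lemma powR_le1D s p r : 0 <= s -> 0 <= r <= p -> s `^ r <= 1 + s `^ p.
Proof.
move=> s0 /andP[r0 rp]; have [s1|/ltW s1] := leP s 1.
  rewrite (@le_trans _ _ 1)//; last by rewrite lerDl powR_ge0.
  have -> : 1 = 1 `^ r :> R by rewrite powR1.
  by rewrite ge0_ler_powR ?nnegrE.
by rewrite (@le_trans _ _ (s `^ p))// ?ler_powR// lerDr.
Qed.

End real_inequalities.

(** * Resampling of coordinates preserves the product measure *)

Section probability_of_measure.
Context {d} {T : measurableType d} {R : realType} {m : {measure set T -> \bar R}}.

(** The proof of total mass one is an argument of the term, so that the probability structure, and
    with it product measures, can be inferred. *)
Definition mprob & m setT = 1%E : set T -> \bar R := m.

Variable m1 : m setT = 1%E.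

HB.instance Definition _ := isMeasure.Build _ _ _ (mprob m1)
  (measure0 m) (measure_ge0 m) (@measure_semi_sigma_additive _ _ _ m).

HB.instance Definition _ := Measure_isProbability.Build _ _ _ (mprob m1) m1.

End probability_of_measure.

Section product_law.
Context {d} {T : measurableType d} {R : realType}.
Implicit Types (N : nat).

Definition rectangle N (B : 'I_N -> set T) : set (N.-tuple T) :=
  [set x | forall i, B i (tnth x i)].

Lemma tnth_mixt N (A : {set 'I_N}) (x y : N.-tuple T) i :
  tnth (mixt A x y) i = if i \in A then tnth x i else tnth y i.
Proof. by rewrite tnth_mktuple. Qed.

Lemma mixt_setC N (A : {set 'I_N}) (x y : N.-tuple T) :
  mixt (~: A) x y = mixt A y x.
Proof. by apply: eq_from_tnth => i; rewrite !tnth_mixt inE; case: (i \in A). Qed.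

Lemma mixtA N (A B : {set 'I_N}) (x y z : N.-tuple T) :
  mixt B (mixt A x y) z = mixt (A :&: B) x (mixt B y z).
Proof.
apply: eq_from_tnth => i; rewrite !tnth_mixt inE.
by case: (i \in A); case: (i \in B).
Qed.

Lemma measurable_rectangle N (B : 'I_N -> set T) :
  (forall i, measurable (B i)) -> measurable (rectangle B).
Proof.
move=> mB; rewrite (_ : rectangle B = \bigcap_i ((@tnth N T)^~ i @^-1` B i)).
  apply: fin_bigcap_measurable => // i _.
  by rewrite -[X in measurable X]setTI; exact: measurable_tnth.
by apply/seteqP; split => [x Bx i _|x Bx i]; [exact: Bx|exact: (Bx i)].
Qed.

(** Rectangles are stable under intersection, as uniqueness of measures requires, and the coordinate
    preimages that generate the tuple sigma-algebra are rectangles with full sides except one. *)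
Lemma measurable_tupleE N : @measurable _ (N.-tuple T) =
  <<s [set A | exists2 B : 'I_N -> set T,
         (forall i, measurable (B i)) & A = rectangle B] >>.
Proof.
apply/seteqP; split; apply: smallest_sub.
- exact: smallest_sigma_algebra.
- rewrite -bigcup_seq/= => _ [i _ [B mB <-]]; apply: sub_sigma_algebra.
  exists (fun j => if j == i then B else setT).
    by move=> j; case: ifP.
  apply/seteqP; split => [x [_ Bx] j|x Bx]; first by case: eqP => // ->.
  by split => //; have /= := Bx i; rewrite eqxx.
- exact: sigma_algebra_measurable.
- by move=> _ [B mB ->]; exact: measurable_rectangle.
Qed.

Lemma measurable_mixt N (A : {set 'I_N}) :
  measurable_fun setT (fun z : N.-tuple T * N.-tuple T => mixt A z.1 z.2).
Proof.
apply/measurable_fun_tnthP => i.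
rewrite (_ : _ \o _ = fun z => if i \in A then tnth z.1 i else tnth z.2 i).
  by case: (i \in A); apply: (measurableT_comp (measurable_tnth i)).
by apply/funext => z /=; rewrite tnth_mixt.
Qed.

Lemma measurable_mixtr N (A : {set 'I_N}) (x : N.-tuple T) :
  measurable_fun setT (mixt A x).
Proof.
apply/measurable_fun_tnthP => i.
rewrite (_ : _ \o _ = fun y => if i \in A then tnth x i else tnth y i).
  by case: (i \in A); [exact: measurable_cst|exact: measurable_tnth].
by apply/funext => y /=; rewrite tnth_mixt.
Qed.

Context {mu : probability T R}.
Context {muN : forall N : nat, {measure set (N.-tuple T) -> \bar R}}.
Hypothesis hprod : is_product_measure_family mu muN.

Lemma muN_setT N : muN N setT = 1%E.
Proof.
have -> : [set: N.-tuple T] = rectangle (fun=> setT).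
  by apply/seteqP; split.
by rewrite hprod// big1// => i _; exact: probability_setT.
Qed.

(** Two independent samples mixed along [A] form a sample of the same law: the preimage of a
    rectangle is a product of two rectangles with sides [B i] or the whole space, so both measures
    agree on a generating family. *)
Lemma mixt_law N (A : {set 'I_N}) (E : set (N.-tuple T)) : measurable E ->
  pushforward (mprob (muN_setT N) \x mprob (muN_setT N))%E (fun z => mixt A z.1 z.2) E = muN N E.
Proof.
pose phi : {mfun (N.-tuple T * N.-tuple T)%type >-> (N.-tuple T)%type} :=
  HB.pack (fun z => mixt A z.1 z.2)
    (isMeasurableFun.Build _ _ _ _ _ (measurable_mixt A)).
apply: (@measure_unique _ _ _ _ (fun=> setT) (measurable_tupleE N) _ _ _
  (pushforward (mprob (muN_setT N) \x mprob (muN_setT N))%E phi) (muN N)).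
- move=> _ _ [B mB ->] [C mC ->]; exists (fun i => B i `&` C i).
    by move=> i; exact: measurableI.
  apply/seteqP; split => [x [Bx Cx] i|x BCx]; first by split; [exact: Bx|exact: Cx].
  by split => i; case: (BCx i).
- move=> _; exists (fun=> setT) => //.
  by apply/seteqP; split.
- by rewrite bigcup_const.
- move=> _ [B mB ->]; change ((mprob (muN_setT N) \x mprob (muN_setT N))%E
    ((fun z => mixt A z.1 z.2) @^-1` rectangle B) = muN N (rectangle B)).
  pose B1 i := if i \in A then B i else setT.
  pose B2 i := if i \in A then setT else B i.
  have mB1 i : measurable (B1 i) by rewrite /B1; case: ifP.
  have mB2 i : measurable (B2 i) by rewrite /B2; case: ifP.
  rewrite (_ : (fun z => mixt A z.1 z.2) @^-1` _ = rectangle B1 `*` rectangle B2); last first.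
    apply/seteqP; split => [[x y] H|[x y] [/= H1 H2] i].
      by split => i /=; have := H i; rewrite /B1 /B2 tnth_mixt; case: ifP.
    by have := H1 i; have := H2 i; rewrite /B1 /B2 tnth_mixt; case: ifP.
  rewrite product_measure1E; [|exact: measurable_rectangle..].
  rewrite /= !hprod// -big_split/=; apply: eq_bigr => i _.
  have mu1 : (mu : {measure set T -> \bar R}) setT = 1%E by exact: probability_setT.
  by rewrite /B1 /B2; case: ifP; rewrite mu1 ?mule1 ?mul1e.
- move=> _; change ((mprob (muN_setT N) \x mprob (muN_setT N))%E setT < +oo)%E.
  by rewrite probability_setT ltry.
Qed.

Local Open Scope ereal_scope.

Lemma measurable_fun_ge0_integral_mixt N (A : {set 'I_N}) (f : N.-tuple T -> \bar R) :
  measurable_fun setT f -> (forall x, 0 <= f x) ->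
  measurable_fun setT (fun x => \int[muN N]_y f (mixt A x y)).
Proof.
move=> mf f0.
apply: (@measurable_fun_fubini_tonelli_F _ _ _ _ R (mprob (muN_setT N))
  (fun z => f (mixt A z.1 z.2))) => //.
exact: measurableT_comp (measurable_mixt A).
Qed.

Lemma ge0_integral_mixt N (A : {set 'I_N}) (f : N.-tuple T -> \bar R) :
  measurable_fun setT f -> (forall x, 0 <= f x) ->
  \int[muN N]_x \int[muN N]_y f (mixt A x y) = \int[muN N]_x f x.
Proof.
move=> mf f0.
rewrite -(@fubini_tonelli1 _ _ _ _ R (mprob (muN_setT N)) (mprob (muN_setT N))
  (fun z => f (mixt A z.1 z.2)))//; last exact: measurableT_comp (measurable_mixt A).
pose phi : {mfun (N.-tuple T * N.-tuple T)%type >-> (N.-tuple T)%type} :=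
  HB.pack (fun z => mixt A z.1 z.2)
    (isMeasurableFun.Build _ _ _ _ _ (measurable_mixt A)).
have -> : \int[muN N]_x f x =
    \int[pushforward (mprob (muN_setT N) \x mprob (muN_setT N)) phi]_x f x.
  by apply: eq_measure_integral => E mE _; rewrite -(mixt_law A mE).
by rewrite ge0_integral_pushforward//; exact: measurable_mixt.
Qed.

Local Close Scope ereal_scope.

(** The integral splits into those of the positive and negative parts, where Tonelli gives
    measurability. *)
Lemma measurable_condE N (A : {set 'I_N}) (f : N.-tuple T -> R) :
  measurable_fun setT f -> measurable_fun setT (condE muN A f).
Proof.
move=> mf; rewrite /condE /Rintegral.
apply: (measurableT_comp (f := fine)) => //=.
under eq_fun do rewrite integralE.
have mF : measurable_fun setT (EFin \o f) by exact/measurable_EFinP.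
apply: emeasurable_funB.
- have := @measurable_fun_ge0_integral_mixt N A _ (measurable_funepos mF)
    (funepos_ge0 _).
  apply: eq_measurable_fun => x _.
  by apply: eq_integral => y _; rewrite !funeposE.
- have := @measurable_fun_ge0_integral_mixt N A _ (measurable_funeneg mF)
    (funeneg_ge0 _).
  apply: eq_measurable_fun => x _.
  by apply: eq_integral => y _; rewrite !funenegE.
Qed.

End product_law.

(** * Conditional expectations of bounded functions *)

(** Locked, so that rewriting treats it as an opaque functional instead of unfolding the
    integral. *)
HB.lock Definition mean {d} {T : measurableType d} {R : realType}
  (muN : forall N : nat, {measure set (N.-tuple T) -> \bar R}) {N : nat}
  (f : N.-tuple T -> R) : R := \int[muN N]_x f x.

Section bounded_measurable.
Context {d} {T : measurableType d} {R : realType}.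
Context {N : nat}.
Implicit Types (f g : N.-tuple T -> R) (A : {set 'I_N}).

(** Such functions are integrable for a probability measure and stable under the operations used
    below, which makes the identities valid at every point. *)
Definition bmeas f := measurable_fun setT f /\ exists M, forall x, `|f x| <= M.

Lemma bmeas_cst c : bmeas (fun=> c).
Proof. by split; [exact: measurable_cst|exists `|c|]. Qed.

Lemma bmeasD f g : bmeas f -> bmeas g -> bmeas (fun x => f x + g x).
Proof.
move=> [mf [M fM]] [mg [M' gM']]; split; first exact: measurable_funD.
by exists (M + M') => x; rewrite (le_trans (ler_normD _ _))// lerD.
Qed.

Lemma bmeasM f g : bmeas f -> bmeas g -> bmeas (fun x => f x * g x).
Proof.
move=> [mf [M fM]] [mg [M' gM']]; split; first exact: measurable_funM.
by exists (M * M') => x; rewrite normrM ler_pM.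
Qed.

Lemma bmeasZ c f : bmeas f -> bmeas (fun x => c * f x).
Proof. by move=> bf; apply: bmeasM => //; exact: bmeas_cst. Qed.

Lemma bmeasB f g : bmeas f -> bmeas g -> bmeas (fun x => f x - g x).
Proof.
move=> bf bg; under eq_fun do rewrite -mulN1r.
by apply: bmeasD => //; exact: bmeasZ.
Qed.

Lemma bmeas_sum (I : Type) (r : seq I) (P : pred I) (F : I -> N.-tuple T -> R) :
  (forall i, bmeas (F i)) -> bmeas (fun x => \sum_(i <- r | P i) F i x).
Proof.
move=> bF; elim: r => [|i r IH].
  by under eq_fun do rewrite big_nil; exact: bmeas_cst.
under eq_fun do rewrite big_cons.
by case: (P i) => //; exact: bmeasD.
Qed.

Lemma bmeas_powR r f : 0 <= r -> bmeas f -> bmeas (fun x => `|f x| `^ r).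
Proof.
move=> r0 [mf [M fM]]; split.
  apply: (measurableT_comp (measurable_powR r)).
  exact: (measurableT_comp (@normr_measurable R setT)).
exists (M `^ r) => x; rewrite ger0_norm ?powR_ge0// ge0_ler_powR ?nnegrE//.
by rewrite (le_trans _ (fM x)).
Qed.

Lemma bmeas_sgpow p f : 1 < p -> bmeas f -> bmeas (fun x => sgpow p (f x)).
Proof.
move=> p1 bf; have p10 : 0 <= p - 1 by lra.
have [_ [M fM]] := bmeas_powR p10 bf.
split; last first.
  by exists M => x; rewrite norm_sgpow ?gt_eqF//; apply: le_trans (ler_norm _) _.
case: bf => mf _; apply: measurable_funM => //.
apply: (measurableT_comp (measurable_powR _)).
exact: (measurableT_comp (@normr_measurable R setT)).
Qed.

Lemma bmeas_mixt A x f : bmeas f -> bmeas (fun y => f (mixt A x y)).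
Proof.
move=> [mf [M fM]]; split; last by exists M.
exact: measurableT_comp (measurable_mixtr _ _).
Qed.

Context {mu : probability T R}.
Context (muN : forall N : nat, {measure set (N.-tuple T) -> \bar R}).
Hypothesis hprod : is_product_measure_family mu muN.

Local Notation mean := (@mean _ _ _ muN N).

Lemma condE_mean A f x : condE muN A f x = mean (fun y => f (mixt A x y)).
Proof. by rewrite mean.unlock. Qed.

Lemma bmeas_integrable f : bmeas f -> (muN N).-integrable setT (EFin \o f).
Proof.
move=> [mf [M fM]]; apply: measurable_bounded_integrable => //.
  by rewrite (muN_setT hprod) ltry.
by exists M; split; [rewrite num_real|move=> x Mx y _; exact: le_trans (ltW Mx)].
Qed.

Lemma meanD f g : bmeas f -> bmeas g ->
  mean (fun x => f x + g x) = mean f + mean g.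
Proof. by move=> bf bg; rewrite mean.unlock RintegralD//; exact: bmeas_integrable. Qed.

Lemma meanZ c f : bmeas f -> mean (fun x => c * f x) = c * mean f.
Proof. by move=> bf; rewrite mean.unlock RintegralZl//; exact: bmeas_integrable. Qed.

Lemma meanB f g : bmeas f -> bmeas g ->
  mean (fun x => f x - g x) = mean f - mean g.
Proof. by move=> bf bg; rewrite mean.unlock RintegralB//; exact: bmeas_integrable. Qed.

Lemma mean_cst c : mean (fun=> c) = c.
Proof. by rewrite mean.unlock Rintegral_cst// (muN_setT hprod) mulr1. Qed.

Lemma mean_sum (I : Type) (r : seq I) (P : pred I) (F : I -> N.-tuple T -> R) :
  (forall i, bmeas (F i)) ->
  mean (fun x => \sum_(i <- r | P i) F i x) = \sum_(i <- r | P i) mean (F i).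
Proof.
move=> bF; elim: r => [|i r IH].
  by rewrite big_nil; under eq_fun do rewrite big_nil; rewrite mean_cst.
rewrite big_cons -IH; under eq_fun do rewrite big_cons.
by case: (P i) => //; rewrite meanD//; exact: bmeas_sum.
Qed.

Lemma le_mean f g : bmeas f -> bmeas g -> (forall x, f x <= g x) ->
  mean f <= mean g.
Proof. by move=> bf bg fg; rewrite mean.unlock; apply: le_Rintegral => //; exact: bmeas_integrable. Qed.

Lemma mean_ge0 f : (forall x, 0 <= f x) -> 0 <= mean f.
Proof. by move=> f0; rewrite mean.unlock; apply: Rintegral_ge0. Qed.

Lemma EFin_mean f : bmeas f -> (mean f)%:E = (\int[muN N]_x (f x)%:E)%E.
Proof.
by move=> bf; rewrite mean.unlock /Rintegral fineK//; exact/integrable_fin_num/bmeas_integrable.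
Qed.

Lemma bmeas_condE A f : bmeas f -> bmeas (condE muN A f).
Proof.
move=> bf; case: (bf) => mf [M fM]; split; first exact: (measurable_condE hprod).
exists M => x.
have bfx := bmeas_mixt A x bf.
apply: le_trans (le_normr_Rintegral _ _) _ => //; first exact: bmeas_integrable.
rewrite (_ : Rintegral _ _ _ = mean (fun y => `|f (mixt A x y)|)); last first.
  by rewrite mean.unlock.
rewrite -[leRHS]mean_cst; apply: le_mean => //; last exact: bmeas_cst.
case: bfx => mfx _; split; last by exists M => y; rewrite normr_id.
exact: (measurableT_comp (@normr_measurable R setT)).
Qed.

(** The Tonelli identity concerns nonnegative functions; it is applied to f + M, where [M] bounds
    |f|, and the constant is then cancelled. *)
Lemma mean_condE A f : bmeas f -> mean (condE muN A f) = mean f.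
Proof.
move=> bf; case: (bf) => mf [M fM].
have bM := @bmeas_cst M.
have bfM : bmeas (fun x => f x + M) by exact: bmeasD.
suff : mean (fun x => condE muN A f x + M) = mean (fun x => f x + M).
  by rewrite !meanD//; [move/addIr|exact: bmeas_condE].
have E x : condE muN A f x + M = mean (fun y => f (mixt A x y) + M).
  by rewrite condE_mean meanD ?mean_cst//; exact: bmeas_mixt.
apply: EFin_inj; rewrite !EFin_mean//; last first.
  by apply: bmeasD => //; exact: bmeas_condE.
rewrite -[RHS](ge0_integral_mixt hprod A); last 2 first.
- by apply/measurable_EFinP; case: bfM.
- by move=> x; rewrite lee_fin -lerBlDr sub0r; have := fM x; rewrite ler_norml => /andP[].
apply: eq_integral => x _; rewrite E EFin_mean//.
exact: (bmeas_mixt A x bfM).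
Qed.

Lemma condED A f g x : bmeas f -> bmeas g ->
  condE muN A (fun x => f x + g x) x = condE muN A f x + condE muN A g x.
Proof. by move=> bf bg; rewrite !condE_mean meanD//; exact: bmeas_mixt. Qed.

Lemma condEB A f g x : bmeas f -> bmeas g ->
  condE muN A (fun x => f x - g x) x = condE muN A f x - condE muN A g x.
Proof. by move=> bf bg; rewrite !condE_mean meanB//; exact: bmeas_mixt. Qed.

Lemma condEZ A c f x : bmeas f ->
  condE muN A (fun x => c * f x) x = c * condE muN A f x.
Proof. by move=> bf; rewrite !condE_mean meanZ//; exact: bmeas_mixt. Qed.

Lemma condE_sum A (I : Type) (r : seq I) (P : pred I) (F : I -> N.-tuple T -> R) x :
  (forall i, bmeas (F i)) ->
  condE muN A (fun x => \sum_(i <- r | P i) F i x) x =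
  \sum_(i <- r | P i) condE muN A (F i) x.
Proof.
move=> bF; rewrite condE_mean mean_sum => [|i]; last exact: (bmeas_mixt A x (bF i)).
by apply: eq_bigr => i _; rewrite condE_mean.
Qed.

(** The two successive resamplings keep [x] on [A :&: B] only; elsewhere two fresh samples are mixed
    along [B], and by [mean_condE] this mixture averages like a single sample. *)
Lemma condE_condE A B f x : bmeas f ->
  condE muN A (condE muN B f) x = condE muN (A :&: B) f x.
Proof.
move=> bf; rewrite [RHS]condE_mean -(mean_condE B (bmeas_mixt _ _ bf)).
rewrite condE_mean; congr mean; apply/funext => y; rewrite !condE_mean.
by congr mean; apply/funext => z; rewrite mixtA.
Qed.

Lemma condE_set0 f x : condE muN finset.set0 f x = mean f.
Proof.
rewrite condE_mean; congr mean; apply/funext => y; congr f.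
by apply: eq_from_tnth => i; rewrite tnth_mixt inE.
Qed.

Lemma condE_setT f x : condE muN [set: 'I_N]%SET f x = f x.
Proof.
rewrite condE_mean -[RHS]mean_cst; congr mean; apply/funext => y; congr f.
by apply: eq_from_tnth => i; rewrite tnth_mixt inE.
Qed.

(** A pointwise form of measurability with respect to the coordinates in [A]. *)
Definition depends A f := forall x y, f (mixt A x y) = f x.

Lemma depends_condE A f : depends A (condE muN A f).
Proof.
move=> x y; rewrite !condE_mean; congr mean; apply/funext => z; congr f.
by apply: eq_from_tnth => i; rewrite !tnth_mixt; case: (i \in A).
Qed.

Lemma condE_pull A f g x : bmeas f -> depends A g ->
  condE muN A (fun x => g x * f x) x = g x * condE muN A f x.
Proof.
move=> bf Ag; rewrite !condE_mean -meanZ; last exact: bmeas_mixt.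
by congr mean; apply/funext => y; rewrite Ag.
Qed.

(** Conditioning on [A] pulls [f] out, and the conditional expectation of [g] is its mean because
    [g] sees the fresh sample only. *)
Lemma mean_indep A f g : bmeas f -> bmeas g -> depends A f ->
  depends (~: A) g -> mean (fun x => f x * g x) = mean f * mean g.
Proof.
move=> bf bg Af Ag; rewrite -(mean_condE A (bmeasM bf bg)).
have -> : condE muN A (fun x => f x * g x) = fun x => mean g * f x.
  apply/funext => x; rewrite condE_pull// mulrC; congr (_ * _).
  by rewrite condE_mean; congr mean; apply/funext => y; rewrite -mixt_setC Ag.
by rewrite meanZ// mulrC.
Qed.

(** Both sides equal the mean of the product of the two conditional expectations. *)
Lemma mean_condE_adj A f g : bmeas f -> bmeas g ->
  mean (fun x => condE muN A f x * g x) = mean (fun x => f x * condE muN A g x).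
Proof.
move=> bf bg; have bcf := bmeas_condE A bf; have bcg := bmeas_condE A bg.
rewrite -(mean_condE A (bmeasM bcf bg)) -(mean_condE A (bmeasM bf bcg)).
congr mean; apply/funext => x; rewrite condE_pull//; last exact: depends_condE.
under [in RHS]eq_fun do rewrite mulrC.
by rewrite condE_pull//; [rewrite mulrC|exact: depends_condE].
Qed.

(** The tangent inequality at [s], the value of the conditional expectation at [x], is averaged; its
    linear term has mean zero. *)
Lemma jensen_condE p A f x : 1 <= p -> bmeas f ->
  `|condE muN A f x| `^ p <= condE muN A (fun y => `|f y| `^ p) x.
Proof.
move=> p1 bf; rewrite [leRHS]condE_mean; set s := condE muN A f x.
have bfx := bmeas_mixt A x bf; have bs := @bmeas_cst s.
have -> : `|s| `^ p =
    mean (fun y => `|s| `^ p + p * (sgpow p s * (f (mixt A x y) - s))).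
  rewrite meanD ?mean_cst; [|exact: bmeas_cst|by do 2 apply: bmeasZ; exact: bmeasB].
  rewrite !meanZ ?meanB ?mean_cst//; [|exact: bmeasB|exact/bmeasZ/bmeasB].
  by rewrite -condE_mean -/s subrr !mulr0 addr0.
apply: le_mean => [||y]; last exact: powR_tangent.
  apply: bmeasD; first exact: bmeas_cst.
  by do 2 apply: bmeasZ; exact: bmeasB.
by apply: (bmeas_powR _ bfx); lra.
Qed.

Lemma jensen_mean_condE p A f : 1 <= p -> bmeas f ->
  mean (fun x => `|condE muN A f x| `^ p) <= mean (fun x => `|f x| `^ p).
Proof.
move=> p1 bf; have p0 : 0 <= p by lra.
rewrite -[leRHS](mean_condE A); last exact: bmeas_powR.
apply: le_mean => [||x]; last exact: jensen_condE.
  by apply: bmeas_powR => //; exact: bmeas_condE.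
by apply: bmeas_condE; exact: bmeas_powR.
Qed.

End bounded_measurable.

(** * The first order projection *)

Section first_order_projection.
Context {d} {T : measurableType d} {R : realType}.
Context {mu : probability T R}.
Context (muN : forall N : nat, {measure set (N.-tuple T) -> \bar R}).
Hypothesis hprod : is_product_measure_family mu muN.

Section fixed_dimension.
Context {N : nat}.
Implicit Types (f g : N.-tuple T -> R) (A B : {set 'I_N}).
Local Notation mean := (mean muN).
Local Notation condE := (condE muN).

Definition hoeff1 (i : 'I_N) f x : R := condE [set i]%SET f x - mean f.

Lemma hoeffP_set1 i f x : hoeffP muN [set i]%SET f x = hoeff1 i f x.
Proof.
rewrite /hoeffP (bigD1 [set i]%SET)//= (bigD1 finset.set0)/=; last first.
  by rewrite finset.sub0set eq_sym; apply/set0Pn; exists i; rewrite inE.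
rewrite big1 ?addr0; last first.
  by move=> B /andP[/andP[]]; rewrite subset1 => /orP[->//|->]; rewrite ?andbF.
rewrite finset.setDv cards0 expr0 mul1r finset.setD0 cards1 expr1 mulN1r.
by rewrite condE_set0.
Qed.

Lemma hoeffPm1 f x : hoeffPm muN 1 f x = \sum_i hoeff1 i f x.
Proof.
rewrite /hoeffPm (eq_bigl (mem [set [set i]%SET | i in 'I_N]%SET)); last first.
  move=> A; rewrite inE; apply/cards1P/imsetP => [[i ->]|[i _ ->]]; by exists i.
rewrite big_imset/=; last by move=> i j _ _; exact: set1_inj.
by apply: eq_bigr => i _; rewrite hoeffP_set1.
Qed.

Lemma bmeas_hoeff1 i f : bmeas f -> bmeas (hoeff1 i f).
Proof.
by move=> bf; apply: bmeasB; [exact: (bmeas_condE hprod)|exact: bmeas_cst].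
Qed.

Lemma depends_hoeff1 i f : depends [set i]%SET (hoeff1 i f).
Proof. by move=> x y; rewrite /hoeff1 depends_condE. Qed.

Lemma depends_sub A B f : A \subset B -> depends A f -> depends B f.
Proof.
move=> AB Af x y; rewrite -(Af _ x); congr f; apply: eq_from_tnth => i.
rewrite !tnth_mixt; case: ifP => // iA.
by rewrite (fintype.subsetP AB).
Qed.

Lemma condE_depends A f x : depends A f -> condE A f x = f x.
Proof.
move=> Af; rewrite condE_mean -[RHS](@mean_cst _ _ _ N _ _ hprod); congr mean.
by apply/funext => y; rewrite Af.
Qed.

Lemma mean_hoeff1 i f : bmeas f -> mean (hoeff1 i f) = 0.
Proof.
move=> bf; rewrite (meanB hprod)//; [|exact: (bmeas_condE hprod)|exact: bmeas_cst].
by rewrite (mean_cst hprod) (mean_condE hprod)// subrr.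
Qed.

Lemma hoeff1Z i c f x : bmeas f ->
  hoeff1 i (fun x => c * f x) x = c * hoeff1 i f x.
Proof. by move=> bf; rewrite /hoeff1 (condEZ hprod)// (meanZ hprod)// mulrBr. Qed.

Lemma mean_hoeff1_adj i f g : bmeas f -> bmeas g ->
  mean (fun x => hoeff1 i f x * g x) = mean (fun x => f x * hoeff1 i g x).
Proof.
move=> bf bg; have bcf := bmeas_condE hprod [set i]%SET bf.
have bcg := bmeas_condE hprod [set i]%SET bg.
under eq_fun do rewrite /hoeff1 mulrBl.
under [in RHS]eq_fun do rewrite /hoeff1 mulrBr [_ * mean g]mulrC.
rewrite !(meanB hprod)//; try (by apply: bmeasM); try (by apply: bmeasZ).
by rewrite !(meanZ hprod)// (mean_condE_adj hprod)// [mean f * _]mulrC.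
Qed.

(** The first [n] coordinates, whose conditional expectations of [f] form the martingale. *)
Let S n : {set 'I_N} := [set i : 'I_N | (i < n)%N]%SET.

Let half_gap (u v b c : R) :
  c <= b -> b + v <= 2^-1 * (u + c) -> v <= 2^-1 * (u - c).
Proof. by lra. Qed.

(** Each [hoeff1 i f] is a conditional expectation of a martingale difference, whose r-th moment
    Clarkson's inequality bounds by an increment of the moments [a n]; the increments telescope. *)
Lemma sum_moment_hoeff1 r f : 2 <= r -> bmeas f ->
  \sum_i mean (fun x => `|hoeff1 i f x| `^ r) <=
  2 `^ r / 2 * mean (fun x => `|f x| `^ r).
Proof.
move=> r2 bf; have r0 : 0 <= r by lra.
have r1 : 1 <= r by lra.
pose a n := mean (fun x => `|condE (S n) f x| `^ r).
have bS n : bmeas (condE (S n) f) by exact: (bmeas_condE hprod).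
have bP g : bmeas g -> bmeas (fun x => `|g x| `^ r) by exact: bmeas_powR.
have SS m n : (m <= n)%N -> S m :&: S n = S m.
  move=> mn; apply/finset.setP => j; rewrite !inE.
  by case: ltnP => //= jm; rewrite (leq_trans jm).
have step (i : 'I_N) : mean (fun x => `|hoeff1 i f x| `^ r) <=
    2 `^ r / 2 * (a i.+1 - a i).
  pose D x := condE (S i.+1) f x - condE (S i) f x.
  pose H x := condE (S i.+1) f x + condE (S i) f x.
  have bD : bmeas D by exact: bmeasB.
  have bH : bmeas (fun x => 2^-1 * H x) by apply: bmeasZ; exact: bmeasD.
  have bD2 : bmeas (fun x => 2^-1 * D x) by apply: bmeasZ.
  (* The index [i] lies in [S i.+1] but not in [S i], so conditioning on it sends the two terms of
     [D] to its own conditional expectation and to the mean. *)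
  have -> : hoeff1 i f = condE [set i]%SET D.
    apply/funext => x; rewrite /D (condEB hprod)// !(condE_condE hprod)//.
    rewrite (_ : _ :&: S i.+1 = [set i])%SET; last first.
      by apply/finset.setP => j; rewrite !inE; case: eqP => //= ->; rewrite ltnSn.
    rewrite (_ : _ :&: S i = finset.set0)%SET; last first.
      by apply/finset.setP => j; rewrite !inE; case: eqP => //= ->; rewrite ltnn.
    by rewrite condE_set0.
  apply: le_trans (jensen_mean_condE hprod _ r1 bD) _.
  (* The midpoint of two successive martingale values has the earlier one as conditional
     expectation, so its moment is at least [a i]. *)
  have aH : a i <= mean (fun x => `|2^-1 * H x| `^ r).
    apply: le_trans (jensen_mean_condE hprod (S i) r1 bH).
    rewrite (_ : condE (S i) (fun x => 2^-1 * H x) = condE (S i) f)//.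
    apply/funext => x; rewrite (condEZ hprod); last exact: bmeasD.
    rewrite (condED hprod)// !(condE_condE hprod)// SS// finset.setIid.
    by lra.
  have K : mean (fun x => `|2^-1 * H x| `^ r + `|2^-1 * D x| `^ r) <=
    mean (fun x => 2^-1 * (`|condE (S i.+1) f x| `^ r + `|condE (S i) f x| `^ r)).
    apply: (le_mean hprod).
    - by apply: bmeasD; exact: bP.
    - by apply: bmeasZ; apply: bmeasD; exact: bP.
    - move=> x; have := clarkson (condE (S i.+1) f x) (condE (S i) f x) r2.
      by rewrite ![_ / 2]mulrC.
  move: K; rewrite (meanD hprod) ?(meanZ hprod) ?(meanD hprod);
    [|by [exact: bP | apply: bmeasD; exact: bP]..].
  move=> K.
  have -> : mean (fun x => `|D x| `^ r) = 2 `^ r * mean (fun x => `|2^-1 * D x| `^ r).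
    rewrite -(meanZ hprod); last exact: bP.
    congr mean; apply/funext => x; rewrite -powRM//; congr (_ `^ _).
    by rewrite normrM ger0_norm ?invr_ge0// mulrA divff// mul1r.
  have T0 : 0 < 2 `^ r :> R by rewrite powR_gt0.
  rewrite -mulrA ler_pM2l//.
  exact: half_gap aH K.
apply: (@le_trans _ _ (\sum_(i < N) 2 `^ r / 2 * (a i.+1 - a i))).
  by apply: ler_sum => i _; exact: step.
rewrite -mulr_sumr ler_wpM2l ?divr_ge0 ?powR_ge0//.
rewrite -(big_mkord xpredT (fun i => a i.+1 - a i)) telescope_sumr//.
have a0 : 0 <= a 0 by apply: mean_ge0 => x; exact: powR_ge0.
have : a N <= mean (fun x => `|f x| `^ r) by exact: (jensen_mean_condE hprod).
by move: (a N) (a 0) (mean _) a0 => u v w; lra.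
Qed.

End fixed_dimension.
End first_order_projection.

(** * Uniform moment bounds for the first order projection *)

Section first_order_bound.
Context {d} {T : measurableType d} {R : realType}.
Context {mu : probability T R}.
Context (muN : forall N : nat, {measure set (N.-tuple T) -> \bar R}).
Hypothesis hprod : is_product_measure_family mu muN.
Local Notation mean := (mean muN).
Local Notation condE := (condE muN).

Section fixed_dimension.
Context {N : nat}.
Implicit Types (f g : N.-tuple T -> R) (A B : {set 'I_N}).
Local Notation P1 f := (fun x => \sum_i hoeff1 muN i f x).

Lemma bmeas_P1 f : bmeas f -> bmeas (P1 f).
Proof. by move=> bf; apply: bmeas_sum => i; exact: (bmeas_hoeff1 hprod). Qed.

Lemma mean_P1_adj f g : bmeas f -> bmeas g ->
  mean (fun x => P1 f x * g x) = mean (fun x => f x * P1 g x).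
Proof.
move=> bf bg; under eq_fun do rewrite mulr_suml.
under [in RHS]eq_fun do rewrite mulr_sumr.
have bh i h := @bmeas_hoeff1 _ _ _ _ _ hprod N i h.
rewrite !(mean_sum hprod); try by move=> i; apply: bmeasM => //; exact: bh.
by apply: eq_bigr => i _; rewrite (mean_hoeff1_adj hprod).
Qed.

(* [sgpow p] is the derivative of [|x|^p / p]; since [hoeff1 i f] is centred and
   independent of the other summands, only the increment of [sgpow p]
   contributes. *)
Lemma moment_P1_increment p C f : 2 <= p ->
  (forall u v, v * (sgpow p (u + v) - sgpow p u) <=
    C * (v ^+ 2 * `|u| `^ (p - 2) + `|v| `^ p)) ->
  bmeas f ->
  mean (fun x => `|\sum_i hoeff1 muN i f x| `^ p) <= C * \sum_i
    (mean (fun x => `|hoeff1 muN i f x| `^ 2) *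
     mean (fun x => `|\sum_(j | j != i) hoeff1 muN j f x| `^ (p - 2)) +
     mean (fun x => `|hoeff1 muN i f x| `^ p)).
Proof.
move=> p2 HC bf.
have bX : bmeas (P1 f) by exact: bmeas_P1.
have bD i : bmeas (hoeff1 muN i f) by exact: (bmeas_hoeff1 hprod).
have bY i : bmeas (fun x => \sum_(j | j != i) hoeff1 muN j f x).
  exact: bmeas_sum.
have p1 : 1 < p by lra.
have dY i : depends (~: [set i]%SET) (fun x => \sum_(j | j != i) hoeff1 muN j f x).
  move=> x y; apply: eq_bigr => j ji.
  apply: (depends_sub _ (@depends_hoeff1 _ _ _ muN N j f)).
  by rewrite finset.sub1set !inE.
have comp (h : R -> R) A g : depends A g -> depends A (fun x => h (g x)).
  by move=> Ag x y; rewrite Ag.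
have -> : (fun x => `|\sum_i hoeff1 muN i f x| `^ p) =
    fun x => \sum_i hoeff1 muN i f x * sgpow p (\sum_i hoeff1 muN i f x).
  by apply/funext => x; rewrite -(@mulr_sgpow _ p) ?mulr_suml// gt_eqF//; lra.
rewrite (mean_sum hprod); last first.
  by move=> i; apply: bmeasM => //; exact: bmeas_sgpow.
rewrite mulr_sumr; apply: ler_sum => i _.
have -> : mean (fun x => hoeff1 muN i f x * sgpow p (\sum_i hoeff1 muN i f x)) =
    mean (fun x => hoeff1 muN i f x *
      (sgpow p (\sum_(j | j != i) hoeff1 muN j f x + hoeff1 muN i f x) -
       sgpow p (\sum_(j | j != i) hoeff1 muN j f x))).
  under [in RHS]eq_fun => x.
    rewrite [_ + hoeff1 muN i f x](_ : _ = \sum_i hoeff1 muN i f x) ?mulrBr.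
      over.
    by rewrite [RHS](bigD1 i)//= addrC.
  rewrite (meanB hprod (bmeasM (bD i) (bmeas_sgpow p1 bX))
    (bmeasM (bD i) (bmeas_sgpow p1 (bY i)))).
  rewrite (mean_indep hprod (bD i) (bmeas_sgpow p1 (bY i))
    (@depends_hoeff1 _ _ _ muN N i f) (comp (sgpow p) _ _ (dY i))).
  by rewrite (mean_hoeff1 hprod)// mul0r subr0.
have bD2 : bmeas (fun x => `|hoeff1 muN i f x| `^ 2) by exact: bmeas_powR.
have bYp : bmeas (fun x => `|\sum_(j | j != i) hoeff1 muN j f x| `^ (p - 2)).
  by apply: bmeas_powR => //; lra.
have bDp : bmeas (fun x => `|hoeff1 muN i f x| `^ p) by apply: bmeas_powR => //; lra.
(* Independence is used backwards: the product of means becomes the mean of a product, which reduces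
   the claim to the pointwise hypothesis on [C]. *)
rewrite -(mean_indep hprod bD2 bYp
  (comp (fun z => `|z| `^ 2) _ _ (@depends_hoeff1 _ _ _ muN N i f))
  (comp (fun z => `|z| `^ (p - 2)) _ _ (dY i))).
rewrite -(meanD hprod (bmeasM bD2 bYp) bDp).
rewrite -(meanZ hprod _ (bmeasD (bmeasM bD2 bYp) bDp)).
apply: (le_mean hprod).
- apply: bmeasM => //; apply: bmeasB; apply: bmeas_sgpow => //.
  exact: bmeasD.
- by apply: bmeasZ; apply: bmeasD => //; exact: bmeasM.
- move=> x; rewrite [`|hoeff1 muN i f x| `^ 2](_ : _ = hoeff1 muN i f x ^+ 2); first exact: HC.
  by rewrite powR_mulrn// real_normK// num_real.
Qed.

(** Conditioning on all coordinates but [i] kills [hoeff1 i f] and fixes the other summands, so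
    Jensen's inequality applies. *)
Lemma moment_P1_drop p i f : 1 <= p -> bmeas f ->
  mean (fun x => `|\sum_(j | j != i) hoeff1 muN j f x| `^ p) <=
  mean (fun x => `|\sum_j hoeff1 muN j f x| `^ p).
Proof.
move=> p1 bf; have bD j : bmeas (hoeff1 muN j f) by exact: (bmeas_hoeff1 hprod).
apply: le_trans (jensen_mean_condE hprod (~: [set i])%SET p1 (bmeas_P1 bf)).
rewrite le_eqVlt; apply/orP; left; apply/eqP; congr mean; apply/funext => x.
congr (`|_| `^ _); rewrite (condE_sum hprod)// [RHS](bigD1 i)//= addrC.
rewrite [X in _ + X](condEB hprod)//; last 2 first.
- exact: (bmeas_condE hprod).
- exact: bmeas_cst.
rewrite (condE_condE hprod)// finset.setIC finset.setICr condE_set0.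
rewrite condE_mean (mean_cst hprod) subrr addr0; apply: eq_bigr => j ji.
rewrite (condE_depends hprod)//.
by apply: (depends_sub _ (@depends_hoeff1 _ _ _ muN N j f)); rewrite finset.sub1set !inE.
Qed.

End fixed_dimension.

(** The coefficient of [M] on the right is 4 C1 / (8 (C1 + 1)), at most one half, so it moves to the
    left. *)
Let absorb4 (M C1 C2 t : R) : 0 <= C1 -> 0 <= M ->
  M <= C1 * (4 * ((8 * (C1 + 1))^-1 * M + C2) + t) ->
  M <= 2 * (C1 * (4 * C2 + t)).
Proof.
move=> C10 M0; set e := _^-1 => H.
have e0 : 0 < e by rewrite invr_gt0; lra.
have : C1 * (4 * (e * M)) <= M / 2.
  have -> : M / 2 = (C1 + 1) * (4 * (e * M)) by rewrite /e; field; lra.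
  by rewrite ler_wpM2r ?mulr_ge0 ?(ltW e0)//; lra.
lra.
Qed.

Lemma absorb_half (t C C3 : R) : 0 <= C -> 0 <= t ->
  t <= C3 + (2 * (C + 1))^-1 * (C * t) -> t <= 2 * C3.
Proof.
move=> C0 t0 H; have : (2 * (C + 1))^-1 * (C * t) <= t / 2.
  have -> : t / 2 = (2 * (C + 1))^-1 * ((C + 1) * t) by field; lra.
  rewrite ler_wpM2l//; first by rewrite invr_ge0; lra.
  by rewrite ler_wpM2r//; lra.
lra.
Qed.

Lemma moment_P1_ge2 p : 2 <= p -> exists2 C, 0 <= C &
  forall N (f : N.-tuple T -> R), bmeas f -> mean (fun x => `|f x| `^ p) <= 1 ->
  mean (fun x => `|\sum_i hoeff1 muN i f x| `^ p) <= C.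
Proof.
move=> p2; have [C1 C10 HC1] := sgpow_increment p2.
pose e := (8 * (C1 + 1))^-1.
have e0 : 0 < e by rewrite invr_gt0; lra.
have [C2 C20 HC2] := powR_interpolate p2 e0.
have T0 := powR_ge0 (2 : R) p.
exists (2 * (C1 * (4 * C2 + 2 `^ p / 2))).
  by rewrite !mulr_ge0// addr_ge0// ?divr_ge0// mulr_ge0.
move=> N f bf f1; have p0 : 0 <= p by lra.
have p1 : 1 <= p by lra.
have bD i : bmeas (hoeff1 muN i f) by exact: (bmeas_hoeff1 hprod).
have bX := bmeas_P1 bf.
have L := moment_P1_increment p2 HC1 bf.
have M0 : 0 <= mean (fun x => `|\sum_i hoeff1 muN i f x| `^ p).
  by apply: mean_ge0 => x; exact: powR_ge0.
(* For r = 2 the factor 2^r/2 is 2, and the second moment of [f] is at most 1 plus its p-th moment,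
   hence at most 2. *)
have S2 : \sum_i mean (fun x => `|hoeff1 muN i f x| `^ 2) <= 4.
  apply: le_trans (sum_moment_hoeff1 hprod (lexx 2) bf) _.
  rewrite powR_mulrn// (_ : 2 ^+ 2 / 2 = 2 :> R); last by field.
  have aux (u v : R) : v <= 1 -> u <= 1 + v -> 2 * u <= 4 by lra.
  apply: aux f1 _.
  have bfp : bmeas (fun x => `|f x| `^ p) by exact: bmeas_powR.
  have b1 := @bmeas_cst d T R N 1.
  rewrite (_ : 1 + _ = mean (fun x => 1 + `|f x| `^ p)); last first.
    by rewrite (meanD hprod b1 bfp) (mean_cst hprod).
  apply: (le_mean hprod); first exact: bmeas_powR.
    by apply: bmeasD => //; exact: bmeas_cst.
  by move=> x; apply: powR_le1D => //; rewrite p2 andbT.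
have Sp : \sum_i mean (fun x => `|hoeff1 muN i f x| `^ p) <= 2 `^ p / 2.
  apply: le_trans (sum_moment_hoeff1 hprod p2 bf) _.
  by rewrite ler_piMr// divr_ge0.
(* Interpolation brings in the p-th moment of the sum without its i-th term, which [moment_P1_drop]
   bounds by that of the full sum. *)
have Yp i : mean (fun x => `|\sum_(j | j != i) hoeff1 muN j f x| `^ (p - 2)) <=
    e * mean (fun x => `|\sum_i hoeff1 muN i f x| `^ p) + C2.
  have bY : bmeas (fun x => \sum_(j | j != i) hoeff1 muN j f x) by exact: bmeas_sum.
  have bYp : bmeas (fun x => `|\sum_(j | j != i) hoeff1 muN j f x| `^ p).
    exact: bmeas_powR.
  apply: (@le_trans _ _ (mean (fun x =>
    e * `|\sum_(j | j != i) hoeff1 muN j f x| `^ p + C2))).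
    apply: (le_mean hprod).
    - by apply: bmeas_powR => //; rewrite subr_ge0.
    - by apply: bmeasD; [exact: bmeasZ|exact: bmeas_cst].
    - by move=> x; exact: HC2.
  rewrite (meanD hprod (bmeasZ e bYp) (@bmeas_cst _ _ _ _ C2)).
  rewrite (mean_cst hprod) (meanZ hprod e bYp) lerD2r ler_pM2l//.
  exact: (moment_P1_drop i p1 bf).
apply: (absorb4 C10 M0).
apply: le_trans L _; rewrite ler_wpM2l// big_split/= lerD//.
apply: (@le_trans _ _ (\sum_i mean (fun x => `|hoeff1 muN i f x| `^ 2) *
    (e * mean (fun x => `|\sum_i hoeff1 muN i f x| `^ p) + C2))).
  apply: ler_sum => i _; rewrite ler_wpM2l//.
  by apply: mean_ge0 => x; exact: powR_ge0.
by rewrite -mulr_suml ler_wpM2r// addr_ge0// mulr_ge0// ltW.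
Qed.

(** Multiplying [f] by t^(-1/p) brings its moment below 1. *)
Lemma moment_P1_scale p k N (f : N.-tuple T -> R) t : 0 < p -> 0 < t ->
  (forall g : N.-tuple T -> R, bmeas g -> mean (fun x => `|g x| `^ p) <= 1 ->
     mean (fun x => `|\sum_i hoeff1 muN i g x| `^ p) <= k) ->
  bmeas f -> mean (fun x => `|f x| `^ p) <= t ->
  mean (fun x => `|\sum_i hoeff1 muN i f x| `^ p) <= k * t.
Proof.
move=> p0 t0 Hk bf ft; have p0' := ltW p0.
pose c := t `^ (- p^-1).
have c0 : 0 <= c by exact: powR_ge0.
have cp : c `^ p = t^-1.
  by rewrite /c -powRrM mulNr mulVf ?gt_eqF// powR_inv1// ltW.
have E (g : N.-tuple T -> R) : bmeas g ->
    mean (fun x => `|c * g x| `^ p) = t^-1 * mean (fun x => `|g x| `^ p).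
  move=> bg; rewrite -(meanZ hprod _ (bmeas_powR p0' bg)).
  by congr mean; apply/funext => x; rewrite normrM powRM// ger0_norm// cp.
have := Hk _ (bmeasZ c bf); rewrite E//.
have -> : (fun x => `|\sum_i hoeff1 muN i (fun x => c * f x) x| `^ p) =
    fun x => `|c * \sum_i hoeff1 muN i f x| `^ p.
  apply/funext => x; rewrite mulr_sumr.
  by congr (`|_| `^ _); apply: eq_bigr => i _; rewrite (hoeff1Z hprod).
rewrite E; last exact: bmeas_P1.
by rewrite ![t^-1 * _]mulrC !ler_pdivrMr// mul1r; exact.
Qed.

Lemma moment_P1_bounded p : 1 < p -> exists2 C, 0 <= C &
  forall N (f : N.-tuple T -> R), bmeas f -> mean (fun x => `|f x| `^ p) <= 1 ->
  mean (fun x => `|hoeffPm muN 1 f x| `^ p) <= C.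
Proof.
move=> p1; suff [C C0 HC] : exists2 C, 0 <= C &
    forall N (f : N.-tuple T -> R), bmeas f -> mean (fun x => `|f x| `^ p) <= 1 ->
    mean (fun x => `|\sum_i hoeff1 muN i f x| `^ p) <= C.
  exists C => // N f bf f1.
  have -> : hoeffPm muN 1 f = fun x => \sum_i hoeff1 muN i f x.
    by apply/funext => x; rewrite hoeffPm1.
  exact: HC.
have [/moment_P1_ge2//|p2] := leP 2 p.
pose q := p / (p - 1).
have q2 : 2 <= q by rewrite /q ler_pdivlMr; lra.
have [C C0 HC] := moment_P1_ge2 q2.
have [C3 C30 HY] : exists2 C3, 0 <= C3 & forall u v : R,
    `|u * v| <= C3 * `|u| `^ p + (2 * (C + 1))^-1 * `|v| `^ q.
  apply: young_eps; [lra|lra| |by rewrite invr_gt0; lra].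
  by rewrite /q; field; lra.
exists (2 * C3); first by rewrite mulr_ge0.
move=> N g bg g1.
have p0 : 0 <= p by lra.
have q0 : 0 < q by lra.
have bY := bmeas_P1 bg.
have [t0|t0] := leP (mean (fun x => `|\sum_i hoeff1 muN i g x| `^ p)) 0.
  by rewrite (le_trans t0)// mulr_ge0.
(* The dual function of X = P_1 g: X f = |X|^p, and |f|^q = |X|^p since (p - 1) q = p. The case of
   exponent [q] bounds P_1 f, and self-adjointness moves P_1 from [g] to [f]. *)
pose f x := sgpow p (\sum_i hoeff1 muN i g x).
have bf : bmeas f by exact: bmeas_sgpow.
have ft : mean (fun x => `|f x| `^ q) =
    mean (fun x => `|\sum_i hoeff1 muN i g x| `^ p).
  congr mean; apply/funext => x; rewrite norm_sgpow ?gt_eqF// -powRrM.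
  by congr (_ `^ _); rewrite /q; field; lra.
have Cf := moment_P1_scale q0 t0 (HC N) bf ltac:(by rewrite ft).
have bPf := bmeas_P1 bf.
(* The parameter 1/(2 (C + 1)) in Young's inequality was chosen to leave at most half of the moment
   on the right. *)
apply: (absorb_half C0 (ltW t0)).
apply: (@le_trans _ _ (C3 * 1 + (2 * (C + 1))^-1 *
  (C * mean (fun x => `|\sum_i hoeff1 muN i g x| `^ p)))); last by rewrite mulr1.
have -> : (fun x => `|\sum_i hoeff1 muN i g x| `^ p) =
    fun x => (\sum_i hoeff1 muN i g x) * f x.
  by apply/funext => x; rewrite mulr_sgpow// gt_eqF//; lra.
rewrite {1}(mean_P1_adj bg bf).
apply: (@le_trans _ _ (mean (fun x => C3 * `|g x| `^ p + (2 * (C + 1))^-1 *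
    `|\sum_i hoeff1 muN i f x| `^ q))).
  apply: (le_mean hprod); first exact: bmeasM.
    by apply: bmeasD; apply: bmeasZ; apply: bmeas_powR => //; exact: ltW.
  by move=> x; apply: le_trans (ler_norm _) (HY _ _).
rewrite (meanD hprod); [|by apply: bmeasZ; apply: bmeas_powR => //; exact: ltW..].
rewrite !(meanZ hprod); [|by apply: bmeas_powR => //; exact: ltW..].
apply: lerD; first by rewrite ler_wpM2l.
rewrite ler_wpM2l//; first by rewrite invr_ge0; lra.
apply: le_trans Cf _; rewrite le_eqVlt; apply/orP; left; apply/eqP.
congr (_ * mean _); apply/funext => x.
by rewrite mulr_sgpow// gt_eqF//; lra.
Qed.

End first_order_bound.

(** * From bounded functions to [L^p] *)

Section ereal_liminf.
Context {R : realType}.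
Implicit Types (u v : (\bar R)^nat) (l : \bar R).
Local Open Scope ereal_scope.

Lemma cvg_le_limn_einf u v l : (forall n, v n <= u n) -> v @ \oo --> l ->
  l <= limn_einf u.
Proof.
move=> vu vl; have [vE _] := cvg_limn_einf_sup vl.
rewrite -vE !limn_einf_lim; apply: lee_lim; [exact: is_cvg_einfs..|].
apply: nearW => n; apply/ereal_infP => _ [k /= nk <-].
by apply: le_trans (vu k); apply: ereal_inf_lbound; exists k.
Qed.

Lemma limn_einf_le u l : (forall n, u n <= l) -> limn_einf u <= l.
Proof.
move=> ul; rewrite limn_einf_lim; apply: lime_le; first exact: is_cvg_einfs.
apply: nearW => n; apply: le_trans (ul n).
by apply: ereal_inf_lbound; exists n => /=.
Qed.

End ereal_liminf.

Section clamp.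
Context {R : realType}.
Implicit Types (n : nat) (x : R).

Definition clamp n x := Num.max (- n%:R) (Num.min x n%:R).

Lemma norm_clamp_le_nat n x : `|clamp n x| <= n%:R.
Proof.
rewrite ler_norml /clamp le_max lexx/= ge_max ge_min lexx orbT andbT.
by rewrite (@le_trans _ _ 0)// oppr_le0.
Qed.

Lemma clamp_id n x : `|x| <= n%:R -> clamp n x = x.
Proof.
by rewrite ler_norml => /andP[nx xn]; rewrite /clamp min_l// max_r.
Qed.

Lemma norm_clamp_le n x : `|clamp n x| <= `|x|.
Proof.
have [/clamp_id->//|/ltW nx] := leP `|x| n%:R.
exact: le_trans (norm_clamp_le_nat _ _) nx.
Qed.

Lemma cvg_clamp x : (fun n => clamp n x) @ \oo --> x.
Proof.
apply: cvg_near_cst; near=> n; apply: clamp_id; near: n.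
exact: nbhs_infty_ger.
Unshelve. all: by end_near. Qed.

Lemma measurable_clamp n : measurable_fun setT (clamp n).
Proof.
apply: measurable_maxr; first exact: measurable_cst.
by apply: measurable_minr; [exact: measurable_id|exact: measurable_cst].
Qed.

End clamp.

Section from_bounded_to_Lp.
Context {d} {T : measurableType d} {R : realType}.
Context {mu : probability T R}.
Context (muN : forall N : nat, {measure set (N.-tuple T) -> \bar R}).
Hypothesis hprod : is_product_measure_family mu muN.
Local Notation mean := (mean muN).
Variable p : R.
Hypothesis p1 : 1 < p.
Variable N : nat.
Implicit Types (f g : N.-tuple T -> R) (A B : {set 'I_N}).

Lemma bmeas_clamp n f : measurable_fun setT f -> bmeas (fun x => clamp n (f x)).
Proof.
move=> mf; split; first exact: measurableT_comp (measurable_clamp n) mf.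
by exists n%:R => x; exact: norm_clamp_le_nat.
Qed.

Lemma bmeas_hoeffP A f : bmeas f -> bmeas (hoeffP muN A f).
Proof.
by move=> bf; apply: bmeas_sum => B; apply: bmeasZ; exact: (bmeas_condE hprod).
Qed.

Lemma bmeas_hoeffPm m f : bmeas f -> bmeas (hoeffPm muN m f).
Proof. by move=> bf; apply: bmeas_sum => A; exact: bmeas_hoeffP. Qed.

Let measurable_cond_sum (I : Type) (r : seq I) (P : pred I)
    (F : I -> N.-tuple T -> R) : (forall i, measurable_fun setT (F i)) ->
  measurable_fun setT (fun x => \sum_(i <- r | P i) F i x).
Proof.
move=> mF; under eq_fun do rewrite big_mkcond/=.
by apply: measurable_sum => i; case: (P i) => //; exact: measurable_cst.
Qed.

Lemma measurable_hoeffPm m f : measurable_fun setT f ->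
  measurable_fun setT (hoeffPm muN m f).
Proof.
move=> mf; apply: measurable_cond_sum => A; apply: measurable_cond_sum => B.
by apply: measurable_funM; [exact: measurable_cst|exact: (measurable_condE hprod)].
Qed.

Lemma cvg_condE_clamp A f x : measurable_fun setT f ->
  (\int[muN N]_y `|f (mixt A x y)|%:E < +oo)%E ->
  (fun n => condE muN A (fun y => clamp n (f y)) x) @ \oo --> condE muN A f x.
Proof.
move=> mf foo.
have mfx : measurable_fun setT (fun y => f (mixt A x y)).
  exact: measurableT_comp (measurable_mixtr _ _).
have ifx : (muN N).-integrable setT (fun y => (f (mixt A x y))%:E).
  by apply/integrableP; split => //; exact/measurable_EFinP.
have [] := @dominated_convergence _ _ _ (muN N) setT measurableT
  (fun n y => (clamp n (f (mixt A x y)))%:E) (fun y => (f (mixt A x y))%:E)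
  (fun y => `|f (mixt A x y)|%:E).
- by move=> n; apply/measurable_EFinP; exact: measurableT_comp (measurable_clamp n) mfx.
- exact/measurable_EFinP.
- apply: aeW => y _; apply: cvg_EFin; first exact: nearW.
  exact: cvg_clamp.
- exact: (integrable_abse ifx).
- by apply: aeW => y n _; rewrite lee_fin norm_clamp_le.
move=> _ _; rewrite -(fineK (integrable_fin_num _ ifx))//.
exact: fine_cvg.
Qed.

Lemma cvg_hoeffPm_clamp m f x : measurable_fun setT f ->
  (forall A, \int[muN N]_y `|f (mixt A x y)|%:E < +oo)%E ->
  (fun n => hoeffPm muN m (fun y => clamp n (f y)) x) @ \oo --> hoeffPm muN m f x.
Proof.
move=> mf foo; apply: cvg_big => [|A _]; first exact: add_continuous.
apply: cvg_big => [|B _]; first exact: add_continuous.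
by apply: cvgMr; exact: cvg_condE_clamp.
Qed.

(** Since |f| <= 1 + |f|^p, the function |f| is integrable; the section integrals average to its
    integral, so they are finite almost everywhere. There are finitely many [A], hence one common
    null set. *)
Lemma ae_section_integrable f : measurable_fun setT f ->
  (\int[muN N]_x (`|f x| `^ p)%:E < +oo)%E ->
  {ae muN N, forall x, forall A, (\int[muN N]_y `|f (mixt A x y)|%:E < +oo)%E}.
Proof.
move=> mf foo; apply: filter_forall => A.
have mnf : measurable_fun setT (fun x => `|f x|%:E).
  by apply/measurable_EFinP; exact: (measurableT_comp (@normr_measurable R setT)).
have mpf : measurable_fun setT (fun x => (`|f x| `^ p)%:E).
  apply/measurable_EFinP; apply: (measurableT_comp (measurable_powR p)).
  exact: (measurableT_comp (@normr_measurable R setT)).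
have f1 : (\int[muN N]_x `|f x|%:E < +oo)%E.
  apply: (@le_lt_trans _ _ (\int[muN N]_x (1 + (`|f x| `^ p)%:E))%E).
    apply: ge0_le_integral => //.
      by apply: emeasurable_funD => //; exact: measurable_cst.
    move=> x _; rewrite -EFinD lee_fin -[leLHS]powRr1//; apply: powR_le1D => //.
    by rewrite ler01 ltW.
  rewrite ge0_integralD//.
  by rewrite integral_cst// (muN_setT hprod) mule1 lte_add_pinfty// ltry.
have F0 x : (0 <= \int[muN N]_y `|f (mixt A x y)|%:E)%E by exact: integral_ge0.
have iF : (muN N).-integrable setT (fun x => \int[muN N]_y `|f (mixt A x y)|%:E)%E.
  apply/integrableP; split.
    exact: (measurable_fun_ge0_integral_mixt hprod A mnf).
  under eq_integral do rewrite gee0_abs//.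
  by rewrite (ge0_integral_mixt hprod A mnf).
have := integrable_ae measurableT iF; apply: filterS => x /(_ Logic.I).
by rewrite ge0_fin_numE.
Qed.

Lemma powR_Lp_le f C : 0 <= C ->
  (LpN muN p f <= C%:E)%E = (\int[muN N]_x (`|f x| `^ p)%:E <= (C `^ p)%:E)%E.
Proof.
move=> C0; have p0 : 0 < p by exact: lt_trans ltr01 p1.
have pn0 : p != 0 by rewrite gt_eqF.
have I0 : (0 <= \int[muN N]_x (`|f x| `^ p)%:E)%E.
  by apply: integral_ge0 => x _; rewrite lee_fin powR_ge0.
have <- : (LpN muN p f `^ p = \int[muN N]_x (`|f x| `^ p)%:E)%E.
  by rewrite /LpN poweR_Lnorm//; apply: eq_integral => x _.
have L0 : (0 <= LpN muN p f)%E by exact: Lnorm_ge0.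
apply/idP/idP => H.
  rewrite -poweR_EFin; apply: gt0_ler_poweR => //; first exact: ltW.
    by rewrite in_itv/= L0 leey.
  by rewrite in_itv/= lee_fin C0 leey.
have := @gt0_ler_poweR R p^-1 _ _ _ _ _ H.
rewrite -poweR_EFin -!poweRrM divff// !poweRe1//; apply.
- by rewrite invr_ge0 ltW.
- by rewrite in_itv/= ?lee_fin ?poweR_ge0 ?powR_ge0 leey.
- by rewrite in_itv/= ?lee_fin ?poweR_ge0 ?powR_ge0 leey.
Qed.

(** The hypothesis applies to the truncations of [f]. Their projections converge almost everywhere
    to that of [f], and Fatou's lemma passes the bound to the limit. *)
Lemma opnormLp_le m C : 0 <= C ->
  (forall g, bmeas g -> mean (fun x => `|g x| `^ p) <= 1 ->
     mean (fun x => `|hoeffPm muN m g x| `^ p) <= C `^ p) ->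
  (opnormLp muN p (@hoeffPm _ _ _ muN N m) <= C%:E)%E.
Proof.
move=> C0 HC; apply: ge_ereal_sup => _ [f [mf f1] <-].
have p0 : 0 <= p by exact: ltW (lt_trans ltr01 p1).
move: f1; rewrite (powR_Lp_le _ ler01) powR1 => f1.
rewrite powR_Lp_le//.
have mpow g : measurable_fun setT g -> measurable_fun setT (fun x => (`|g x| `^ p)%:E).
  move=> mg; apply/measurable_EFinP; apply: (measurableT_comp (measurable_powR p)).
  exact: (measurableT_comp (@normr_measurable R setT)).
pose fn n x := clamp n (f x).
have bfn n : bmeas (fn n) by exact: bmeas_clamp.
have Hn n : (\int[muN N]_x (`|hoeffPm muN m (fn n) x| `^ p)%:E <= (C `^ p)%:E)%E.
  rewrite -(EFin_mean hprod); last by apply: bmeas_powR => //; exact: bmeas_hoeffPm.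
  rewrite lee_fin; apply: HC => //; rewrite -lee_fin (EFin_mean hprod); last first.
    exact: bmeas_powR.
  apply: le_trans f1; apply: ge0_le_integral => //.
  - by apply: mpow; case: (bfn n).
  - exact: mpow.
  - move=> x _; rewrite lee_fin ge0_ler_powR ?nnegrE//; exact: norm_clamp_le.
apply: le_trans (limn_einf_le Hn).
have fat := @fatou _ _ _ (muN N) setT measurableT
  (fun n x => (`|hoeffPm muN m (fn n) x| `^ p)%:E).
apply: le_trans (fat _ _); last 2 first.
- by move=> n; apply: mpow; exact: measurable_hoeffPm (proj1 (bfn n)).
- by move=> n x _; rewrite lee_fin powR_ge0.
apply: ae_ge0_le_integral => //.
- by apply: mpow; exact: measurable_hoeffPm.
- move=> x _; apply: (@cvg_le_limn_einf _ _ (fun=> 0%E)); last exact: cvg_cst.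
  by move=> n; rewrite lee_fin powR_ge0.
(* The lower limit is the opposite of the upper limit of the opposite sequence, which yields its
   measurability. *)
- apply: (measurableT_comp (f := -%E)) => //.
  apply: measurable_fun_limn_esup => n; apply: (measurableT_comp (f := -%E)) => //.
  by apply: mpow; exact: measurable_hoeffPm (proj1 (bfn n)).
have := ae_section_integrable mf (le_lt_trans f1 (ltry _)).
apply: filterS => x foo _.
have cx := cvg_hoeffPm_clamp (m := m) mf foo.
set s := hoeffPm muN m f x in cx *.
(* The tangent at the limit [s] is an affine minorant converging to |s|^p, which suffices for a
   lower bound of the lower limit. *)
apply: (@cvg_le_limn_einf _ _ (fun n => (`|s| `^ p +
    p * (sgpow p s * (hoeffPm muN m (fn n) x - s)))%:E)).
  by move=> n; rewrite lee_fin powR_tangent// ltW.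
apply: cvg_EFin; first exact: nearW.
rewrite -[X in _ --> X]addr0; apply: cvgD; first exact: cvg_cst.
rewrite -(mulr0 p); apply: cvgMr; rewrite -(mulr0 (sgpow p s)); apply: cvgMr.
by rewrite -(subrr s); apply: cvgB => //; exact: cvg_cst.
Qed.

Lemma moment_le_opnormLp m k g : 0 <= k ->
  (opnormLp muN p (@hoeffPm _ _ _ muN N m) <= k%:E)%E ->
  bmeas g -> mean (fun x => `|g x| `^ p) <= 1 ->
  mean (fun x => `|hoeffPm muN m g x| `^ p) <= k `^ p.
Proof.
move=> k0 Hk bg g1; have p0 : 0 <= p by exact: ltW (lt_trans ltr01 p1).
rewrite -lee_fin (EFin_mean hprod); last first.
  by apply: bmeas_powR => //; exact: bmeas_hoeffPm.
rewrite -powR_Lp_le//; apply: le_trans Hk; apply: ereal_sup_ubound.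
exists g => //; split; first by case: bg.
rewrite (powR_Lp_le _ ler01) powR1 -(EFin_mean hprod) ?lee_fin//.
exact: bmeas_powR.
Qed.

End from_bounded_to_Lp.

(** * Sets and colourings *)

Section combinatorics.
Context {R : realType} {N : nat}.
Implicit Types (A B C W S : {set 'I_N}).

(** Sets without [i] are paired with their extensions by [i], and each pair cancels. *)
Lemma sum_toggle0 (F : {set 'I_N} -> R) i :
  (forall C, i \notin C -> F (i |: C)%SET = - F C) -> \sum_C F C = 0.
Proof.
move=> FN; rewrite (bigID (fun C => i \in C))/=.
rewrite [X in X + _](reindex_onto (fun C => i |: C)%SET (fun C => C :\ i)%SET); last first.
  by move=> C iC; rewrite finset.setD1K.
rewrite [X in X + _](eq_bigl (fun C => i \notin C)) => [|C].
  rewrite -big_split/= big1// => C iC.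
  by rewrite FN// addNr.
rewrite setU11/=; apply/eqP/idP => [<-|iC]; first by rewrite !inE eqxx.
by rewrite setU1K.
Qed.

Lemma sign_toggle A C i : i \in A -> i \notin C ->
  (-1) ^+ #|A :\: (i |: C)| = - (-1) ^+ #|A :\: C| :> R.
Proof.
move=> iA iC; rewrite [in RHS](cardsD1 i) !inE iA iC/= add1n exprS mulN1r opprK.
by congr (_ ^+ #|pred_of_set _|); apply/finset.setP => j; rewrite !inE; case: (j == i); case: (j \in A); case: (j \in C).
Qed.

(** The summand at [i] is 1 exactly when [W] is the singleton of [i], the empty set being cancelled
    by the second indicator. For W = A ∩ S this is the eigenvalue of [blockP1 S] on P_A. *)
Lemma sum_indic_fibre W S : W \subset S ->
  \sum_(i in S) ((W \subset [set i]%SET)%:R - (W \subset finset.set0)%:R) =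
  (#|W| == 1%N)%:R :> R.
Proof.
move=> WS; rewrite finset.subset0; have [->|W0] := eqVneq W finset.set0.
  by rewrite cards0 big1// => i _; rewrite finset.sub0set subrr.
under eq_bigr => i _ do rewrite finset.subset1 (negPf W0) orbF subr0.
have [/cards1P[j Wj]|W1] := boolP (#|W| == 1%N).
  have jS : j \in S by apply: (fintype.subsetP WS); rewrite Wj inE.
  rewrite (bigD1 j)//= Wj eqxx big1 ?addr0// => i /andP[_ ij].
  by case: eqP => // /set1_inj ji; rewrite ji eqxx in ij.
rewrite big1// => i _; case: eqP => // Wi.
by rewrite Wi cards1 in W1.
Qed.

(** The condition says that the colouring restricts to a bijection from [A] to the [m] colours,
    giving m! choices, while the N - m other coordinates are free. *)
Lemma count_split_colourings m A : #|A| = m ->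
  #|[set c : {ffun 'I_N -> 'I_m} |
      [forall j, #|A :&: (c @^-1: [set j]%SET)| == 1%N]]%SET| = (m`! * m ^ (N - m))%N.
Proof.
move=> Am.
pose al (j : 'I_m) : 'I_N := enum_val (cast_ord (esym Am) j).
have al_inj : injective al by move=> j k /enum_val_inj/cast_ord_inj.
have alA j : al j \in A by exact: enum_valP.
have alP i : i \in A -> exists j, i = al j.
  move=> iA; exists (cast_ord Am (enum_rank_in iA i)).
  by rewrite /al cast_ordK enum_rankK_in.
pose r (c : {ffun 'I_N -> 'I_m}) : {ffun 'I_m -> 'I_m} := [ffun j => c (al j)].
have fibre (c : {ffun 'I_N -> 'I_m}) j :
    A :&: (c @^-1: [set j]%SET) = [set al k | k in (r c) @^-1: [set j]%SET]%SET.
  apply/finset.setP => i; rewrite !inE; apply/andP/imsetP.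
    move=> [/alP[k ->] /eqP ck]; exists k => //.
    by rewrite !inE ffunE ck.
  by move=> [k]; rewrite !inE ffunE => ck ->.
have splitE (c : {ffun 'I_N -> 'I_m}) :
    [forall j, #|A :&: (c @^-1: [set j]%SET)| == 1%N] = injectiveb (r c).
  apply/forallP/injectiveP => [H k l rkl|ri j].
    have := H (r c k); rewrite fibre card_imset// => /cards1P[x rx].
    have : k \in [set x]%SET by rewrite -rx !inE.
    have : l \in [set x]%SET by rewrite -rx !inE rkl.
    by rewrite !inE => /eqP-> /eqP->.
  rewrite fibre card_imset//; apply/cards1P; exists (invF ri j).
  by apply/finset.setP => k; rewrite !inE -[k == _](inj_eq ri) f_invF.
rewrite (eq_card (B := [pred c | injectiveb (r c)])); last first.
  by move=> c; rewrite !inE splitE.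
rewrite -sum1_card.
rewrite (partition_big r (fun g => injectiveb g))/=; last by move=> c; rewrite inE.
rewrite (eq_bigr (fun=> m ^ (N - m))%N) => [|g gi].
  rewrite sum_nat_const; congr (_ * _)%N.
  have := card_inj_ffuns 'I_m 'I_m; rewrite card_ord ffactnn => <-.
  by rewrite cardsE.
rewrite sum1_card.
(* Colourings with prescribed restriction [g] form a product of allowed values: one colour at each
   point of [A], every colour elsewhere. *)
pose F (i : 'I_N) : pred 'I_m := fun u => [forall k, (al k == i) ==> (u == g k)].
rewrite (eq_card (B := family F)); last first.
  move=> c; rewrite !inE; apply/andP/familyP.
    move=> [_ /eqP rg] i; apply/forallP => k; apply/implyP => /eqP <-.
    by rewrite -rg ffunE.
  move=> H; have rg : r c = g.
    apply/ffunP => k; have /forallP/(_ k) := H (al k).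
    by rewrite eqxx/= ffunE => /eqP.
  by split; [rewrite inE rg|rewrite rg].
rewrite card_family foldrE big_map big_enum/=.
rewrite (bigID (fun i => i \in A))/= big1 ?mul1n; last first.
  move=> i /alP[k ->]; rewrite -(card1 (g k)); apply: eq_card => u; rewrite !inE.
  apply/forallP/eqP => [/(_ k)|->]; first by rewrite eqxx => /eqP.
  by move=> l; apply/implyP => /eqP/al_inj ->.
rewrite (eq_bigr (fun=> m)) => [|i iA].
  rewrite prod_nat_const; congr (_ ^ _)%N.
  have H := cardC (mem A); rewrite card_ord Am in H.
  have mN : (m <= N)%N by have := max_card (mem A); rewrite card_ord Am.
  by apply: (@addnI m); rewrite (subnKC mN) -[RHS]H.
rewrite -[RHS]card_ord; apply: eq_card => u; rewrite !inE.
by apply/forallP => k; apply/implyP => /eqP ki; rewrite -ki alA in iA.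
Qed.

Lemma split_colouring_card m A (c : {ffun 'I_N -> 'I_m}) :
  [forall j, #|A :&: (c @^-1: [set j]%SET)| == 1%N] -> #|A| = m.
Proof.
move=> /forallP H; rewrite -sum1_card (partition_big c predT)//=.
rewrite (eq_bigr (fun=> 1%N)) ?sum1_card ?card_ord// => j _.
rewrite sum1_card -(eqP (H j)); apply: eq_card => i.
by rewrite !inE.
Qed.

End combinatorics.

(** Induction, where the step is (1 + 1/(m+1))^(m+1) <= e, a consequence of 1 + x <= e^x. *)
Lemma expn_le_fact_expR {R : realType} m :
  (m.+1 ^ m.+1)%:R <= (m.+1)`!%:R * expR 1 ^+ m :> R.
Proof.
elim: m => [|m IH]; first by rewrite expr0 mulr1.
have m0 : 0 < m.+1%:R :> R by rewrite ltr0n.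
have H : m.+2%:R ^+ m.+1 <= m.+1%:R ^+ m.+1 * expR 1 :> R.
  have -> : m.+2%:R = m.+1%:R * (1 + m.+1%:R^-1) :> R.
    by rewrite mulrDr mulr1 divff ?gt_eqF// -[in LHS]natr1.
  rewrite exprMn ler_wpM2l ?exprn_ge0 ?ler0n//.
  have -> : expR 1 = expR (m.+1%:R^-1) ^+ m.+1 :> R.
    by rewrite -expRM_natl mulfV// gt_eqF.
  apply: lerXn2r; rewrite ?nnegrE ?expR_ge0 ?expR_ge1Dx//.
rewrite natrX exprS factS natrM.
have -> : m.+2%:R * (m.+1)`!%:R * expR 1 ^+ m.+1 =
    m.+2%:R * ((m.+1)`!%:R * expR 1 ^+ m * expR 1) :> R by rewrite exprS; ring.
rewrite ler_pM2l ?ltr0n//; apply: le_trans H _.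
by rewrite ler_wpM2r ?expR_ge0// -natrX.
Qed.

(** * Higher order projections *)

Section higher_order.
Context {d} {T : measurableType d} {R : realType}.
Context {mu : probability T R}.
Context (muN : forall N : nat, {measure set (N.-tuple T) -> \bar R}).
Hypothesis hprod : is_product_measure_family mu muN.
Local Notation mean := (mean muN).
Local Notation condE := (condE muN).

Section hoeffding_decomposition.
Context {N : nat}.
Implicit Types (f g : N.-tuple T -> R) (A B C S : {set 'I_N}).

(** If [A] is contained in [B], no term changes. Otherwise toggling a point of [A] outside [B] flips
    the sign and keeps [B :&: C], so the sum cancels. *)
Lemma condE_hoeffP A B f x : bmeas f ->
  condE B (hoeffP muN A f) x = (A \subset B)%:R * hoeffP muN A f x.
Proof.
move=> bf; rewrite [LHS](condE_sum hprod); last first.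
  by move=> C; apply: bmeasZ; exact: (bmeas_condE hprod).
have E C : condE B (fun y => (-1) ^+ #|A :\: C| * condE C f y) x =
    (-1) ^+ #|A :\: C| * condE (B :&: C) f x.
  by rewrite (condEZ hprod) ?(condE_condE hprod)//; exact: (bmeas_condE hprod).
under eq_bigr do rewrite E.
have [AB|/subsetPn[i iA iB]] := boolP (A \subset B).
  rewrite mul1r; apply: eq_bigr => C CA.
  by rewrite (finset.setIidPr (fintype.subset_trans CA AB)).
rewrite mul0r big_mkcond/=; apply: (@sum_toggle0 _ _ _ i) => C iC.
rewrite finset.subUset finset.sub1set iA/=; case: ifP; last by rewrite oppr0.
have -> : (B :&: (i |: C) = B :&: C)%SET.
  apply/finset.setP => j; rewrite !inE; case: eqP => //= ->.
  by rewrite (negPf iB).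
by move=> CA; rewrite sign_toggle// mulNr.
Qed.

(** After exchanging the sums, the coefficient of each E_B with [B] proper vanishes by toggling a
    point outside [B]; only the identity E_[1,N] remains. *)
Lemma hoeffding_decomposition f x : \sum_A hoeffP muN A f x = f x.
Proof.
rewrite /hoeffP; under eq_bigr do rewrite big_mkcond/=.
rewrite exchange_big/= (bigD1 [set: 'I_N]%SET)//= [X in _ + X]big1 ?addr0.
  rewrite (bigD1 [set: 'I_N]%SET)//= big1 ?addr0 => [|A].
    by rewrite fintype.subxx finset.setDv cards0 expr0 mul1r (condE_setT hprod).
  by rewrite finset.subTset => /negPf ->.
move=> B; rewrite -finset.subTset => /subsetPn[i _ iB].
apply: (@sum_toggle0 _ _ _ i) => A iA.
have -> : (B \subset i |: A)%SET = (B \subset A).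
  apply/fintype.subsetP/fintype.subsetP => BA j jB; last by rewrite !inE BA ?orbT.
  have := BA j jB; rewrite !inE => /orP[/eqP ji|//].
  by rewrite -ji jB in iB.
case: ifP => [BA|]; last by rewrite oppr0.
have -> : ((i |: A) :\: B = i |: (A :\: B))%SET.
  by apply/finset.setP => j; rewrite !inE; case: eqP => //= ->; rewrite iB.
by rewrite cardsU1 !inE (negPf iA) andbF/= add1n exprS mulN1r mulNr.
Qed.

End hoeffding_decomposition.

(** * First order projections on blocks and averages over colourings *)

Section block_projection.
Context {N : nat}.
Implicit Types (f g : N.-tuple T -> R) (A B C S : {set 'I_N}).

(* [P_1] acting on the coordinates in [S] with the other ones frozen. *)
Definition blockP1 S f x : R :=
  \sum_(i in S) (condE (~: S :|: [set i])%SET f x - condE (~: S) f x).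

Lemma bmeas_blockP1 S f : bmeas f -> bmeas (blockP1 S f).
Proof.
by move=> bf; apply: bmeas_sum => i; apply: bmeasB; exact: (bmeas_condE hprod).
Qed.

Lemma blockP1_sum S (I : Type) (r : seq I) (P : pred I)
    (F : I -> N.-tuple T -> R) x : (forall i, bmeas (F i)) ->
  blockP1 S (fun x => \sum_(i <- r | P i) F i x) x =
  \sum_(i <- r | P i) blockP1 S (F i) x.
Proof.
move=> bF; rewrite [RHS]exchange_big/=; apply: eq_bigr => i _.
by rewrite !(condE_sum hprod)// -sumrB.
Qed.

(** [A] lies in the complement of [S] enlarged by [i] exactly when A ∩ S lies in the singleton of
    [i], so [sum_indic_fibre] computes the factor. *)
Lemma blockP1_hoeffP S A f x : bmeas f ->
  blockP1 S (hoeffP muN A f) x = (#|A :&: S| == 1%N)%:R * hoeffP muN A f x.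
Proof.
move=> bf; rewrite -(@sum_indic_fibre R _ _ S); last exact: finset.subsetIr.
rewrite mulr_suml; apply: eq_bigr => i iS.
rewrite !condE_hoeffP// -mulrBl; congr ((_%:R - _%:R) * _); congr nat_of_bool.
- apply/fintype.subsetP/fintype.subsetP => H j.
    by rewrite !inE => /andP[/H]; rewrite !inE => /orP[/negPf ->|->].
  move=> jA; have := H j; rewrite !inE jA/=; case: (j \in S) => //=.
  by apply.
- apply/fintype.subsetP/fintype.subsetP => H j.
    by rewrite !inE => /andP[/H]; rewrite !inE => /negPf ->.
  move=> jA; have := H j; rewrite !inE jA/=; case: (j \in S) => //=.
  by apply.
Qed.

(** The section does not see the coordinates outside [S], so their terms in the full first order
    projection vanish and those in [S] remain. *)
Lemma blockP1_section S f x z :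
  blockP1 S f (mixt S x z) = hoeffPm muN 1 (fun y => f (mixt S y z)) x.
Proof.
rewrite hoeffPm1 (bigID (fun i => i \in S))/= [X in _ = _ + X]big1 ?addr0.
  apply: eq_bigr => i iS; rewrite /hoeff1; congr (_ - _); rewrite ?condE_mean.
    congr (mean _); apply/funext => y; congr f; apply: eq_from_tnth => j.
    by rewrite !tnth_mixt !inE; case: eqP => [->|]; rewrite ?iS//=; case: (j \in S).
  congr (mean _); apply/funext => y; congr f; apply: eq_from_tnth => j.
  by rewrite !tnth_mixt !inE; case: (j \in S).
move=> i iS; rewrite /hoeff1; apply/eqP; rewrite subr_eq0; apply/eqP.
rewrite condE_mean; congr (mean _).
apply/funext => y; congr f; apply: eq_from_tnth => j.
rewrite !tnth_mixt !inE; case: ifP => // jS; case: eqP => // ji.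
by rewrite -ji jS in iS.
Qed.

(** Fubini: after conditioning on the complement of [S], the assumed bound is applied to each
    section, regarded as a function of all coordinates. *)
Lemma moment_blockP1 p k S f : 1 <= p ->
  (forall g, bmeas g -> mean (fun x => `|hoeffPm muN 1 g x| `^ p) <=
     k * mean (fun x => `|g x| `^ p)) ->
  bmeas f ->
  mean (fun x => `|blockP1 S f x| `^ p) <= k * mean (fun x => `|f x| `^ p).
Proof.
move=> p1 Hk bf; have p0 : 0 <= p by lra.
have bQ : bmeas (fun x => `|blockP1 S f x| `^ p).
  by apply: bmeas_powR => //; exact: bmeas_blockP1.
have bfp : bmeas (fun x => `|f x| `^ p) by exact: bmeas_powR.
rewrite -(mean_condE hprod (~: S) bQ) -(mean_condE hprod (~: S) bfp).
rewrite -(meanZ hprod k (bmeas_condE hprod _ bfp)).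
apply: (le_mean hprod); [exact: (bmeas_condE hprod)| |].
  by apply: bmeasZ; exact: (bmeas_condE hprod).
move=> z; rewrite !condE_mean.
have -> : (fun y => `|blockP1 S f (mixt (~: S) z y)| `^ p) =
    fun y => `|hoeffPm muN 1 (fun y => f (mixt S y z)) y| `^ p.
  by apply/funext => y; rewrite mixt_setC blockP1_section.
have -> : (fun y => `|f (mixt (~: S) z y)| `^ p) = fun y => `|f (mixt S y z)| `^ p.
  by apply/funext => y; rewrite mixt_setC.
apply: Hk; have := bmeas_mixt (~: S) z bf.
by under eq_fun do rewrite mixt_setC.
Qed.

Section colouring.
Context {m : nat}.
Implicit Types (c : {ffun 'I_N -> 'I_m}) (s : seq 'I_m).

(** The list [s] is arbitrary for the sake of induction; the composition over all colours is the
    case [enum 'I_m]. *)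
Definition colourP c s f : N.-tuple T -> R :=
  foldr (fun j g => blockP1 (c @^-1: [set j]%SET) g) f s.

Lemma bmeas_colourP c s f : bmeas f -> bmeas (colourP c s f).
Proof. by move=> bf; elim: s => //= j s IH; exact: bmeas_blockP1. Qed.

Lemma colourPE c s f x : bmeas f -> colourP c s f x =
  \sum_A (all (fun j => #|A :&: (c @^-1: [set j]%SET)| == 1%N) s)%:R *
    hoeffP muN A f x.
Proof.
move=> bf; elim: s x => [|j s IH] x /=.
  under eq_bigr do rewrite mul1r.
  by rewrite hoeffding_decomposition.
have -> : colourP c s f = fun x => \sum_A
    (all (fun j => #|A :&: (c @^-1: [set j]%SET)| == 1%N) s)%:R * hoeffP muN A f x.
  by apply/funext => y; exact: IH.
have bP A := bmeas_hoeffP hprod A bf.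
rewrite blockP1_sum => [|A]; last exact: bmeasZ.
apply: eq_bigr => A _.
transitivity ((all (fun j => #|A :&: (c @^-1: [set j]%SET)| == 1%N) s)%:R *
    blockP1 (c @^-1: [set j]%SET) (hoeffP muN A f) x).
  rewrite [in RHS]/blockP1 mulr_sumr; apply: eq_bigr => i _.
  by rewrite !(condEZ hprod)// mulrBr.
rewrite blockP1_hoeffP//.
by case: (_ == _); rewrite /= ?mul1r// !mul0r mulr0.
Qed.

Lemma moment_colourP p k c s f : 1 <= p -> 0 <= k ->
  (forall g, bmeas g -> mean (fun x => `|hoeffPm muN 1 g x| `^ p) <=
     k * mean (fun x => `|g x| `^ p)) ->
  bmeas f -> mean (fun x => `|colourP c s f x| `^ p) <=
     k ^+ size s * mean (fun x => `|f x| `^ p).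
Proof.
move=> p1 k0 Hk bf; elim: s => [|j s IH] /=; first by rewrite expr0 mul1r.
apply: le_trans (moment_blockP1 _ p1 Hk (bmeas_colourP c s bf)) _.
by rewrite exprS -mulrA ler_wpM2l.
Qed.

(** The coefficient of P_A is the number of colourings under which [A] meets each class once, which
    is zero unless |A| = m. *)
Lemma sum_colourP f x : bmeas f ->
  \sum_c colourP c (enum 'I_m) f x =
  (m`! * m ^ (N - m))%:R * hoeffPm muN m f x.
Proof.
move=> bf; under eq_bigr do rewrite colourPE//.
rewrite exchange_big/= /hoeffPm mulr_sumr [RHS]big_mkcond/=.
apply: eq_bigr => A _; rewrite -mulr_suml.
have E c : all (fun j => #|A :&: (c @^-1: [set j]%SET)| == 1%N) (enum 'I_m) =
    [forall j, #|A :&: (c @^-1: [set j]%SET)| == 1%N].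
  apply/allP/forallP => H j; first by apply: H; rewrite mem_enum.
  by move=> _; exact: H.
under eq_bigr do rewrite E.
case: ifP => [/eqP Am|Am].
  rewrite -(count_split_colourings Am) -sum1_card natr_sum [in RHS]big_mkcond/=.
  by congr (_ * _); apply: eq_bigr => c _; rewrite inE; case: ifP.
rewrite big1 ?mul0r// => c _; case: (boolP [forall j, _]) => [/split_colouring_card Am'|//].
by rewrite Am' eqxx in Am.
Qed.

End colouring.
End block_projection.

(** Tangents at the average are summed, and their linear terms cancel. *)
Lemma jensen_average p (I : finType) (F : I -> R) : 1 <= p -> (0 < #|I|)%N ->
  `|#|I|%:R^-1 * \sum_i F i| `^ p <= #|I|%:R^-1 * \sum_i `|F i| `^ p.
Proof.
move=> p1 I0; set s := _ * _.
have n0 : 0 < #|I|%:R :> R by rewrite ltr0n.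
rewrite ler_pdivlMl//.
apply: le_trans (ler_sum _ (fun i _ => powR_tangent s (F i) p1)).
rewrite big_split/= sumr_const mulr_natl lerDl -!mulr_sumr.
rewrite [\sum_i _](_ : _ = 0) ?mulr0//.
rewrite sumrB sumr_const -[s *+ _]mulr_natl /s mulrA divff ?gt_eqF// mul1r.
by rewrite subrr.
Qed.

Lemma moment_hoeffPm p k N m (f : N.-tuple T -> R) : 1 <= p -> 0 <= k ->
  (forall g : N.-tuple T -> R, bmeas g ->
     mean (fun x => `|hoeffPm muN 1 g x| `^ p) <= k * mean (fun x => `|g x| `^ p)) ->
  bmeas f -> (0 < m)%N ->
  mean (fun x => `|hoeffPm muN m f x| `^ p) <=
  ((m ^ m)%:R / m`!%:R) `^ p * (k ^+ m * mean (fun x => `|f x| `^ p)).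
Proof.
move=> p1 k0 Hk bf m0; have p0 : 0 <= p by lra.
pose I := {ffun 'I_N -> 'I_m}.
have cI : #|I| = (m ^ N)%N by rewrite card_ffun !card_ord.
have I0 : (0 < #|I|)%N by rewrite cI expn_gt0 m0.
pose w : R := (m`! * m ^ (N - m))%:R.
have w0 : 0 < w by rewrite ltr0n muln_gt0 fact_gt0 expn_gt0 m0.
have n0 : 0 < #|I|%:R :> R by rewrite ltr0n.
pose avg x := #|I|%:R^-1 * \sum_(c : I) colourP c (enum 'I_m) f x.
have bc (c : I) : bmeas (colourP c (enum 'I_m) f) by exact: bmeas_colourP.
have bavg : bmeas avg by apply: bmeasZ; exact: bmeas_sum.
have bcp (c : I) : bmeas (fun x => `|colourP c (enum 'I_m) f x| `^ p).
  exact: bmeas_powR.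
have M0 : 0 <= mean (fun x => `|f x| `^ p).
  by apply: mean_ge0 => x; exact: powR_ge0.
have avgE : mean (fun x => `|avg x| `^ p) <= k ^+ m * mean (fun x => `|f x| `^ p).
  apply: (@le_trans _ _ (mean (fun x => #|I|%:R^-1 *
      \sum_(c : I) `|colourP c (enum 'I_m) f x| `^ p))).
    apply: (le_mean hprod); first exact: bmeas_powR.
      by apply: bmeasZ; exact: bmeas_sum.
    by move=> x; exact: jensen_average.
  rewrite (meanZ hprod _ (bmeas_sum _ _ bcp)) (mean_sum hprod _ _ bcp).
  rewrite ler_pdivrMl// mulr_natl -sumr_const; apply: ler_sum => c _.
  have := moment_colourP c (enum 'I_m) p1 k0 Hk bf.
  by rewrite size_enum_ord.
have PE : hoeffPm muN m f = fun x => #|I|%:R / w * avg x.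
  have aux (n v P : R) : n != 0 -> v != 0 -> P = n / v * (n^-1 * (v * P)).
    by move=> ? ?; field; apply/andP.
  by apply/funext => x; rewrite /avg sum_colourP//; apply: aux; rewrite gt_eqF.
have q0 : 0 <= #|I|%:R / w by rewrite divr_ge0 ?ltW.
have -> : mean (fun x => `|hoeffPm muN m f x| `^ p) =
    (#|I|%:R / w) `^ p * mean (fun x => `|avg x| `^ p).
  rewrite -(meanZ hprod _ (bmeas_powR p0 bavg)); congr mean; apply/funext => x.
  by rewrite PE normrM powRM// ger0_norm.
apply: ler_pM => //; [exact: powR_ge0|by apply: mean_ge0 => x; exact: powR_ge0|].
apply: ge0_ler_powR => //; rewrite ?nnegrE// ?divr_ge0//.
rewrite ler_pdivrMr// mulrAC ler_pdivlMr ?ltr0n ?fact_gt0//.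
rewrite cI /w -!natrM ler_nat mulnCA mulnC leq_pmul2l ?fact_gt0//.
(* Truncated subtraction gives N <= m + (N - m), with equality exactly when m <= N. *)
by rewrite -expnD leq_pexp2l// -leq_subLR.
Qed.

Lemma moment_hoeffPm1_homogeneous p k N (f : N.-tuple T -> R) : 0 < p -> 0 <= k ->
  (forall g : N.-tuple T -> R, bmeas g -> mean (fun x => `|g x| `^ p) <= 1 ->
     mean (fun x => `|hoeffPm muN 1 g x| `^ p) <= k) ->
  bmeas f ->
  mean (fun x => `|hoeffPm muN 1 f x| `^ p) <= k * mean (fun x => `|f x| `^ p).
Proof.
move=> p0 k0 Hk bf.
have PE g : hoeffPm muN 1 g = fun x : N.-tuple T => \sum_i hoeff1 muN i g x.
  by apply/funext => x; rewrite hoeffPm1.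
have H t : 0 < t -> mean (fun x => `|f x| `^ p) <= t ->
    mean (fun x => `|hoeffPm muN 1 f x| `^ p) <= k * t.
  move=> t0; rewrite PE; apply: (moment_P1_scale hprod p0 t0) => // g bg g1.
  by have := Hk g bg g1; rewrite PE.
have := mean_ge0 muN (fun x => powR_ge0 `|f x| p).
(* If the moment of [f] is zero, every t > 0 is admissible in [H]; a [t] proportional to the moment
   [M0] of the projection forces that moment to vanish. *)
rewrite le_eqVlt => /predU1P[f0|f0]; last exact: H.
have M0 := mean_ge0 muN (fun x => powR_ge0 `|hoeffPm muN 1 f x| p).
rewrite -f0 mulr0 -(mulr0 2) leNgt; apply/negP => M1.
have := M1; rewrite ltNge => /negP; apply.
apply: (absorb_half k0 M0); rewrite add0r mulrCA; apply: H; last rewrite -f0.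
  by rewrite mulr_gt0 ?invr_gt0//; [lra|rewrite mulr0 in M1].
by rewrite mulr_ge0 ?invr_ge0//; lra.
Qed.

End higher_order.

(** * From moment bounds to operator norms *)

Theorem theorem3p1 (d : measure_display) (T : measurableType d) (R : realType)
    (mu : probability T R)
    (muN : forall N : nat, {measure set (N.-tuple T) -> \bar R})
    (hprod : is_product_measure_family mu muN)
    (p : R) (hp : 1 < p) :
  let K := ereal_sup (range (fun N : nat => opnormLp muN p (@hoeffPm _ _ _ muN N 1))) in
  (K < +oo)%E /\
  forall m : nat, (1 <= m)%N ->
    (ereal_sup (range (fun N : nat => opnormLp muN p (@hoeffPm _ _ _ muN N m)))
       <= (expR (-1))%:E * ((expR 1)%:E * K) ^+ m)%E.
Proof.
move=> K.
have p0 : 0 < p by lra.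
have Koo : (K < +oo)%E.
  have [C C0 HC] := moment_P1_bounded hprod hp.
  apply: (@le_lt_trans _ _ (C `^ p^-1)%:E); last exact: ltry.
  apply: ge_ereal_sup => _ [N _ <-].
  apply: (opnormLp_le hprod hp (powR_ge0 _ _)) => g bg g1.
  by rewrite -powRrM mulVf ?gt_eqF// powRr1//; exact: HC.
split=> // m m1.
(* The zero function in dimension 0 is a test function; with finiteness this makes [K] a nonnegative
   real [k]. *)
have K0 : (0 <= K)%E.
  apply: (@le_trans _ _ (opnormLp muN p (@hoeffPm _ _ _ muN 0 1))); last first.
    by apply: ereal_sup_ubound; exists 0%N.
  apply: (@le_trans _ _ (LpN muN p (@hoeffPm _ _ _ muN 0 1 (fun=> 0)))).
    exact: Lnorm_ge0.
  apply: ereal_sup_ubound; exists (fun=> 0) => //; split => //.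
  by rewrite /LpN (_ : EFin \o _ = cst 0%E)// Lnorm0 ?lee_fin// eqe gt_eqF.
have [k k0 Kk] : exists2 k : R, 0 <= k & K = k%:E.
  exists (fine K); first exact: fine_ge0.
  by rewrite fineK// ge0_fin_numE.
have Hk N (g : N.-tuple T -> R) : bmeas g ->
    mean muN (fun x => `|hoeffPm muN 1 g x| `^ p) <=
    k `^ p * mean muN (fun x => `|g x| `^ p).
  move=> bg; apply: (moment_hoeffPm1_homogeneous hprod p0 (powR_ge0 _ _)) => // g' bg' g1.
  apply: (moment_le_opnormLp hprod hp k0) => //.
  by rewrite -Kk; apply: ereal_sup_ubound; exists N.
have -> : ((expR (-1))%:E * ((expR 1)%:E * K) ^+ m =
    (expR (-1) * (expR 1 * k) ^+ m)%:E)%E by rewrite Kk EFinM EFin_expe EFinM.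
have B0 : 0 <= expR (-1) * (expR 1 * k) ^+ m.
  by rewrite mulr_ge0 ?expR_ge0// exprn_ge0// mulr_ge0 ?expR_ge0.
apply: ge_ereal_sup => _ [N _ <-].
apply: (opnormLp_le hprod hp B0) => g bg g1.
apply: le_trans (moment_hoeffPm hprod (ltW hp) (powR_ge0 _ _) (@Hk N) bg m1) _.
have kp : (k `^ p) ^+ m = (k ^+ m) `^ p.
  by rewrite -(powR_mulrn m (powR_ge0 k p)) -(powR_mulrn m k0) powRAC.
apply: (@le_trans _ _ (((m ^ m)%:R / m`!%:R) `^ p * (k ^+ m) `^ p)).
  by rewrite kp ler_wpM2l ?powR_ge0// ler_piMr ?powR_ge0.
have km0 : 0 <= k ^+ m by exact: exprn_ge0.
have mm0 : 0 <= (m ^ m)%:R / m`!%:R :> R by rewrite divr_ge0.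
rewrite -powRM//; apply: ge0_ler_powR; rewrite ?nnegrE//; [exact: ltW|exact: mulr_ge0|].
rewrite exprMn mulrA; apply: ler_wpM2r => //.
(* What remains is m^m / m! <= e^(m-1), shifted to [m.+1], where the factor e^(-1) cancels one
   factor [e]. *)
case: m m1 {B0 kp km0 mm0} => // m _.
rewrite exprS mulrA -expRD addNr expR0 mul1r ler_pdivrMr ?ltr0n ?fact_gt0//.
by rewrite mulrC; exact: expn_le_fact_expR.
Qed.
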